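(* Let $\alpha>0$ and let $r\in C(0,+\infty)$ satisfy $r(x)>0$ for all $x>0$, $\int_0^1\frac{d\tau}{r(\tau)}=+\infty$, $\int_1^\infty\frac{d\tau}{r(\tau)}=+\infty$, and $\sup_{z>0}\frac{r(z)}{z}<+\infty$ (resp. $\sup_{z>0}\frac{r(z)}{1+z}<+\infty$). Let the sublevel sets of $a$ be thin at zero and at infinity in the sense that for any $c>0$ $$\int_0^{+\infty}1_{\{a<c\}}(y)\frac{1}{r(y)}\,dy<+\infty$$ (e.g. let $\lim_{x\to+\infty}a(x)=+\infty$ and $\lim_{x\to0}a(x)=+\infty$). Then $T$ is resolvent compact in $X_\alpha$ (resp. in $X_{0,\alpha}$).
   Context: $X_{\alpha}:=L^1(\mathbb{R}_+;x^\alpha dx)$ and $X_{0,\alpha}:=L^1(\mathbb{R}_+;(1+x)^\alpha dx)$, $\mathbb{R}_+=(0,+\infty)$. The function $a\in L^1_{loc}(0,+\infty)$ is nonnegative. For $t\ge0$ and $y>0$, $X(y,t)\in(0,y]$ is defined by $\int_{X(y,t)}^y\frac{d\tau}{r(\tau)}=t$. $T$ is the generator, in $X_\alpha$ (resp. in $X_{0,\alpha}$), of the positive $C_0$-semigroup $(U(t))_{t\ge0}$ given by $$(U(t)f)(y)=e^{-\int_{X(y,t)}^y\frac{a(p)}{r(p)}dp}\,\frac{r(X(y,t))f(X(y,t))}{r(y)}.$$ ''Resolvent compact'' means that the resolvent operators $(\lambda-T)^{-1}$ are compact. *)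

(* Defs.v *)
From HB Require Import structures.
From mathcomp Require Import all_boot all_order all_algebra.
From mathcomp Require Import all_classical all_reals all_analysis.
From mathcomp Require Import measurable_realfun.

Set Implicit Arguments.
Unset Strict Implicit.
Unset Printing Implicit Defensive.
Import Order.TTheory GRing.Theory Num.Theory.
Import numFieldNormedType.Exports.
Local Open Scope classical_set_scope.
Local Open Scope ring_scope.

(* The library provides the type of classes [LspaceType1 mu], but no linear or
   metric structure on it; it is made here a normed space over R. *)
Section L1_normed.
Context d (T : measurableType d) (R : realType).
Variable mu : {measure set T -> \bar R}.
Local Notation L := (LspaceType1 mu).
Local Notation F := (LfunType mu (@lexx _ _ 1%E)).
Implicit Types (x y z : L) (f g : F) (a : R).

Definition L1_repr x : {mfun T >-> measurableTypeR R} :=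
  repr (LebesgueSpace.sort x).

Lemma L1_repr_mfun x : measurable_fun [set: T] (L1_repr x : T -> R).
Proof. exact: (@measurable_funPT _ _ _ _ (L1_repr x)). Qed.

Lemma L1_repr_Lfun x : (L1_repr x : T -> R) \in Lfun mu 1%E.
Proof.
apply/andP; split; first by rewrite inE; exact: L1_repr_mfun.
by rewrite inE; exact: (@Lebesgue_finite _ _ _ _ _ _ x).
Qed.

Definition L1_fun x : F := Lfun_Sub (@lexx _ _ 1%E) (L1_repr_Lfun x).

Lemma L1_funE x : (L1_fun x : T -> R) = x :> (T -> R).
Proof. by []. Qed.

Lemma L1_ext x y : (x : T -> R) = y %[ae mu] -> x = y.
Proof.
move=> xy; have : LebesgueSpace.sort x = LebesgueSpace.sort y.
  apply/eqP; rewrite -[LebesgueSpace.sort x]reprK -[LebesgueSpace.sort y]reprK.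
  by rewrite eqmodE; apply/asboolP.
case: x y {xy} => [u [[pu]]] [v [[pv]]] /= uv.
by case: v / uv pv => pv; rewrite (Prop_irrelevance pu pv).
Qed.

Definition to_mfun f : T -> measurableTypeR R := f.

Lemma measurable_to_mfun f : measurable_fun [set: T] (to_mfun f).
Proof. exact: (@measurable_funPT _ _ _ _ f). Qed.

HB.instance Definition _ f :=
  isMeasurableFun.Build _ _ _ _ (to_mfun f) (measurable_to_mfun f).

Definition mfun_class f : {mfun_ mu, T >-> measurableTypeR R} :=
  \pi_({mfun_ mu, T >-> measurableTypeR R})%qT (to_mfun f).

Lemma mfun_classE f : (mfun_class f : T -> R) = f %[ae mu].
Proof.
by have /eqP := reprK (mfun_class f); rewrite eqmodE => /asboolP.
Qed.

Lemma ae_and (P Q : set T) : (\forall t \ae mu, P t) -> (\forall t \ae mu, Q t) ->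
  \forall t \ae mu, P t /\ Q t.
Proof. exact: filterI. Qed.

Lemma ae_eq_N1 (f g : T -> R) : measurable_fun setT f -> measurable_fun setT g ->
  f = g %[ae mu] -> 'N[mu]_1[EFin \o f]%E = 'N[mu]_1[EFin \o g]%E.
Proof.
move=> mf mg fg; rewrite !Lnorm1; apply: ge0_ae_eq_integral => //.
- by apply: measurableT_comp => //; exact/measurable_EFinP.
- by apply: measurableT_comp => //; exact/measurable_EFinP.
- by apply: filterS fg => t /(_ I) /= ->.
Qed.

Lemma mfun_class_finite f : finite_norm mu 1 (mfun_class f).
Proof.
rewrite /finite_norm (@ae_eq_N1 _ f).
- exact: (@Lfunction_finite _ _ _ _ _ (@lexx _ _ 1%E) f).
- exact: (@measurable_funPT _ _ _ _ (repr (mfun_class f))).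
- exact: (@measurable_funPT _ _ _ _ f).
- exact: mfun_classE.
Qed.

HB.instance Definition _ f := isFinLebesgue.Build _ T R mu 1%E (@lexx _ _ 1%E)
  (mfun_class f) (mfun_class_finite f).

Definition L1_class f : L := mfun_class f.

Lemma L1_classE f : (L1_class f : T -> R) = f %[ae mu].
Proof. exact: mfun_classE. Qed.

Definition L1_zero : L := L1_class 0.
Definition L1_opp x := L1_class (- L1_fun x).
Definition L1_add x y := L1_class (L1_fun x + L1_fun y).
Definition L1_scale a x := L1_class (a *: L1_fun x).
Definition L1_norm x : R := fine 'N[mu]_1[EFin \o x]%E.

Lemma L1_zeroE : (L1_zero : T -> R) = (fun=> 0) %[ae mu].
Proof. exact: L1_classE. Qed.

Lemma L1_oppE x : (L1_opp x : T -> R) = (fun t => - x t) %[ae mu].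
Proof. exact: L1_classE. Qed.

Lemma L1_addE x y : (L1_add x y : T -> R) = (fun t => x t + y t) %[ae mu].
Proof. exact: L1_classE. Qed.

Lemma L1_scaleE a x : (L1_scale a x : T -> R) = (fun t => a * x t) %[ae mu].
Proof. exact: L1_classE. Qed.

Lemma L1_addA : associative L1_add.
Proof.
move=> x y z; apply: L1_ext.
have := ae_and (L1_addE x (L1_add y z)) (L1_addE y z).
have := ae_and (L1_addE (L1_add x y) z) (L1_addE x y).
apply: filterS2 => t [/(_ I) e2 /(_ I) e1] [/(_ I) e4 /(_ I) e3] _.
by rewrite e4 e3 e2 e1 addrA.
Qed.

Lemma L1_addC : commutative L1_add.
Proof.
move=> x y; apply: L1_ext; have := L1_addE x y; have := L1_addE y x.
by apply: filterS2 => t /(_ I) e1 /(_ I) e2 _; rewrite e1 e2 addrC.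
Qed.

Lemma L1_add0 : left_id L1_zero L1_add.
Proof.
move=> x; apply: L1_ext; have := L1_addE L1_zero x; have := L1_zeroE.
by apply: filterS2 => t /(_ I) e1 /(_ I) e2 _; rewrite e2 e1 add0r.
Qed.

Lemma L1_addN : left_inverse L1_zero L1_opp L1_add.
Proof.
move=> x; apply: L1_ext; have := L1_addE (L1_opp x) x.
have := L1_zeroE; have := L1_oppE x.
by apply: filterS3 => t /(_ I) e1 /(_ I) e2 /(_ I) e3 _; rewrite e3 e2 e1 addNr.
Qed.

HB.instance Definition _ := gen_eqMixin (LspaceType1 mu).
HB.instance Definition _ := gen_choiceMixin (LspaceType1 mu).
HB.instance Definition _ := GRing.isZmodule.Build (LspaceType1 mu)
  L1_addA L1_addC L1_add0 L1_addN.

Lemma L1_scaleA a b x : L1_scale a (L1_scale b x) = L1_scale (a * b) x.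
Proof.
apply: L1_ext; have := L1_scaleE a (L1_scale b x).
have := L1_scaleE b x; have := L1_scaleE (a * b) x.
apply: filterS3 => t /(_ I) e1 /(_ I) e2 /(_ I) e3 _.
by rewrite e3 e2 e1 mulrA.
Qed.

Lemma L1_scale1 : left_id 1 L1_scale.
Proof.
move=> x; apply: L1_ext; have := L1_scaleE 1 x.
by apply: filterS => t /(_ I) e1 _; rewrite e1 mul1r.
Qed.

Lemma L1_scaleDr : right_distributive L1_scale L1_add.
Proof.
move=> a x y; apply: L1_ext; have := L1_scaleE a (L1_add x y).
have := ae_and (L1_addE x y) (L1_addE (L1_scale a x) (L1_scale a y)).
have := ae_and (L1_scaleE a x) (L1_scaleE a y).
apply: filterS3 => t [/(_ I) e2 /(_ I) e1] [/(_ I) e4 /(_ I) e3] /(_ I) e5 _.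
by rewrite e5 e4 e3 e2 e1 mulrDr.
Qed.

Lemma L1_scaleDl x a b : L1_scale (a + b) x = L1_add (L1_scale a x) (L1_scale b x).
Proof.
apply: L1_ext; have := L1_scaleE (a + b) x.
have := L1_addE (L1_scale a x) (L1_scale b x).
have := ae_and (L1_scaleE a x) (L1_scaleE b x).
apply: filterS3 => t [/(_ I) e2 /(_ I) e1] /(_ I) e3 /(_ I) e4 _.
by rewrite e4 e3 e2 e1 mulrDl.
Qed.

HB.instance Definition _ := GRing.Zmodule_isLmodule.Build R (LspaceType1 mu)
  L1_scaleA L1_scale1 L1_scaleDr (fun x a b => L1_scaleDl x a b).

Lemma L1_norm_class f : L1_norm (L1_class f) = fine 'N[mu]_1[EFin \o f]%E.
Proof.
congr fine; apply: ae_eq_N1; last exact: L1_classE.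
- exact: L1_repr_mfun.
- exact: (@measurable_funPT _ _ _ _ f).
Qed.

Lemma L1_ler_normD x y : L1_norm (x + y) <= L1_norm x + L1_norm y.
Proof.
by rewrite L1_norm_class; exact: (@ler_LnormD _ _ _ mu _ _ (L1_fun x) (L1_fun y)).
Qed.

Lemma L1_normrZ a x : L1_norm (a *: x) = `|a| * L1_norm x.
Proof.
rewrite L1_norm_class.
have -> : 'N[mu]_1[EFin \o (a *: L1_fun x)]%E = (`|a|%:E * 'N[mu]_1[EFin \o x])%E.
  exact: (@LnormZ _ _ _ mu _ _ (L1_fun x) a).
by rewrite fineM// -(@finite_norm_fine _ _ _ mu _ _ (L1_fun x)).
Qed.

Lemma L1_normr0_eq0 x : L1_norm x = 0 -> x = 0.
Proof.
move=> x0; apply: L1_ext.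
have := L1_zeroE; have := @fine_Lnormr_eq0 _ _ _ mu _ _ (L1_fun x) x0.
by apply: filterS2 => t /(_ I) e1 /(_ I) e2 _; rewrite [LHS]e1 e2.
Qed.

HB.instance Definition _ := Lmodule_isNormed.Build R (LspaceType1 mu)
  L1_ler_normD L1_normrZ L1_normr0_eq0.

End L1_normed.

(* The set of positive reals; the interval notation is ambiguous in
   [ereal_scope]. *)
Definition Rpos {R : realType} : set R := `]0, +oo[.

Lemma measurable_Rpos {R : realType} : measurable (@Rpos R).
Proof. exact: measurable_itv. Qed.

Section weighted_measures.
Context (R : realType).
Local Notation leb := (@lebesgue_measure R).

Lemma density_sigma_additive (w : R -> R) :
  measurable_fun [set: R] w -> (forall x, 0 <= w x) ->
  semi_sigma_additive
    (fun A : set R => (\int[leb]_(x in A `&` Rpos) (w x)%:E)%E).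
Proof.
move=> mw w0 /= A mA tA mUA; rewrite setI_bigcupl.
rewrite ge0_integral_bigcup//=.
- apply: is_cvg_ereal_nneg_natsum_cond => n _ _.
  by apply: integral_ge0 => x _; rewrite lee_fin.
- by move=> n; apply: measurableI; [exact: mA|exact: measurable_Rpos].
- by apply/measurable_funTS; exact/measurable_EFinP.
- by move=> x _; rewrite lee_fin.
- by move: tA; exact: trivIset_setIr.
Qed.

(* x^alpha dx, resp. (1+x)^alpha dx, on ]0, +oo[; the complement of ]0, +oo[
   is given measure zero, so the L^1 spaces below are spaces on ]0, +oo[. *)
Definition powR_measure (alpha : R) (A : set R) : \bar R :=
  (\int[leb]_(x in A `&` Rpos) (x `^ alpha)%:E)%E.

Definition powR1D_measure (alpha : R) (A : set R) : \bar R :=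
  (\int[leb]_(x in A `&` Rpos) ((1 + x) `^ alpha)%:E)%E.

Let powR_measure0 alpha : powR_measure alpha set0 = 0%E.
Proof. by rewrite /powR_measure set0I integral_set0. Qed.

Let powR_measure_ge0 alpha A : (0 <= powR_measure alpha A)%E.
Proof. by apply: integral_ge0 => x _; rewrite lee_fin powR_ge0. Qed.

Let powR_measure_sigma_additive alpha : semi_sigma_additive (powR_measure alpha).
Proof.
apply: (@density_sigma_additive (fun x => x `^ alpha)) => [|x].
- exact: measurable_powR.
- exact: powR_ge0.
Qed.

HB.instance Definition _ alpha := isMeasure.Build _ _ _ (powR_measure alpha)
  (powR_measure0 alpha) (powR_measure_ge0 alpha)
  (@powR_measure_sigma_additive alpha).

Let powR1D_measure0 alpha : powR1D_measure alpha set0 = 0%E.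
Proof. by rewrite /powR1D_measure set0I integral_set0. Qed.

Let powR1D_measure_ge0 alpha A : (0 <= powR1D_measure alpha A)%E.
Proof. by apply: integral_ge0 => x _; rewrite lee_fin powR_ge0. Qed.

Let powR1D_measure_sigma_additive alpha :
  semi_sigma_additive (powR1D_measure alpha).
Proof.
apply: (@density_sigma_additive (fun x => (1 + x) `^ alpha)) => [|x].
- apply: (measurableT_comp (measurable_powR alpha)).
  exact: measurable_funD.
- exact: powR_ge0.
Qed.

HB.instance Definition _ alpha := isMeasure.Build _ _ _ (powR1D_measure alpha)
  (powR1D_measure0 alpha) (powR1D_measure_ge0 alpha)
  (@powR1D_measure_sigma_additive alpha).

End weighted_measures.

Notation X_space alpha := (LspaceType1 (powR_measure alpha)).
Notation X0_space alpha := (LspaceType1 (powR1D_measure alpha)).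

Section operators.
Context (R : realType) (V : normedModType R).
Implicit Types (U : R -> V -> V) (D : V -> V -> Prop).

(* Only the restriction of [U] to nonnegative times is meaningful. *)
Definition C0_semigroup U : Prop :=
  [/\ forall t, 0 <= t -> linear (U t) /\ continuous (U t),
      forall f, U 0 f = f,
      forall s t f, 0 <= s -> 0 <= t -> U (s + t) f = U s (U t f) &
      forall f, U t f @[t --> 0^'+] --> f].

(* An unbounded operator is represented by its graph: [D f g] means that f is
   in the domain and is mapped to g. *)
Definition generator U : V -> V -> Prop :=
  fun f g => t^-1 *: (U t f - f) @[t --> 0^'+] --> g.

(* K = (lambda - D)^-1 as an everywhere defined bounded operator *)
Definition is_resolvent D (lambda : R) (K : {linear V -> V}) : Prop :=
  [/\ continuous K,
      forall g, exists2 h, D (K g) h & lambda *: K g - h = g &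
      forall f h, D f h -> K (lambda *: f - h) = f].

Definition resolvent_set D : set R :=
  [set lambda | exists K, is_resolvent D lambda K].

Definition compact_operator (K : {linear V -> V}) : Prop :=
  forall B : set V, bounded_set B -> precompact (K @` B).

(* Nonemptiness is required so that the compactness is not vacuous. *)
Definition resolvent_compact D : Prop :=
  resolvent_set D !=set0 /\
  forall lambda K, is_resolvent D lambda K -> compact_operator K.

End operators.

Section transport.
Context (R : realType).
Local Notation leb := (@lebesgue_measure R).
Implicit Types (r a : R -> R).

(* X(y, t); the default value 0 is not used when 1/r is not integrable at 0. *)
Definition backward_flow r (y t : R) : R :=
  xget 0 [set x | 0 < x <= y /\
    (\int[leb]_(tau in `[x, y]) ((r tau)^-1)%:E = t%:E)%E].

Definition transport_formula r a (t : R) (f : R -> R) (y : R) : R :=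
  let x := backward_flow r y t in
  expR (- \int[leb]_(p in `[x, y]) (a p / r p)) * (r x * f x / r y).

Definition given_by_transport r a (mu : {measure set R -> \bar R})
    (U : R -> LspaceType1 mu -> LspaceType1 mu) : Prop :=
  forall t (f : LspaceType1 mu), 0 <= t ->
    \forall y \ae mu, 0 < y -> U t f y = transport_formula r a t f y.

End transport.

(* Main.v *)
Require Import Defs.
From HB Require Import structures.
From mathcomp Require Import all_boot all_order all_algebra.
From mathcomp Require Import all_classical all_reals all_analysis.
From mathcomp Require Import measurable_realfun.
From mathcomp Require Import ring lra.

(** The flow of r, used as a time coordinate, turns the transport into a
    translation.  Let H(x) be the integral of 1/r from 1 to x and G its inverse;
    the two divergent integrals make H a bijection of ]0, +oo[ onto the line.
    For F(u) = r(G u) f(G u), A = a o G and W = w o G, where w is the weight,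
    f |-> F is an isometry onto L^1(line; W du) (norm_pull, pull_surj) which
    turns U(t) into the damped translation
      V(t) F (u) = e^{- (P(u) - P(u - t))} F(u - t),  P a primitive of A
    (transport_pull).  The bound r(z) <= C (c + z), with c = 0 or c = 1, gives
    W(u + t) <= e^{om t} W(u) for om = alpha C (weight_growth), and thinness of
    the sublevel sets of a says that {A < c} has finite Lebesgue measure.

    Let lam = om + 1 and Q(u) = lam u + P(u).  Integrating e^{- lam t} V(t) F over
    t >= 0 gives
      K F (u) = int_{s <= u} e^{Q(s) - Q(u)} F(s) ds,
    and K is the resolvent at lam.  Indeed K F - e^{- lam t} V(t) K F is the
    integral of e^{- lam tau} V(tau) F over 0 <= tau <= t, so that strong
    continuity of U at 0 gives generator_K; conversely K commutes with U, hence
    with the generator (K_left_inverse).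

    Two estimates make K compact: |K F| W <= |F| at every point
    (green_op_pointwise), and the integral of (1 + A) |K F| W is at most |F|
    (green_op_absorption), where |F| is the norm of F in L^1(W du).  Outside a
    large interval, the second one controls K F where A >= c and the first one
    where A < c, since this set has finite measure; so the images of a bounded
    set have uniformly small tails (green_op_tail).  Inside the interval, on a
    cell ]p, p + h] the function K F equals e^{Q(p) - Q(u)} K F(p) plus the
    integral over ]p, u], and summing these remainders over the cells costs at
    most h |F|.  Hence K is approximated, uniformly on bounded sets, by
    operators of finite rank (green_op_finite_rank), and completeness of L^1
    gives the compactness (compact_K).  The resolvent identity passes it to all
    other points of the resolvent set (resolvent_compact_one). *)

Set Implicit Arguments.
Unset Strict Implicit.
Unset Printing Implicit Defensive.
Import Order.TTheory GRing.Theory Num.Theory.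
Import numFieldNormedType.Exports.
Local Open Scope classical_set_scope.
Local Open Scope ring_scope.

(** * Compact operators and resolvents *)

Section compactness.
Context (R : realType).

Lemma ultra_bounded_cvg (T : Type) (F : set_system T) (c : T -> R) (M : R) :
  UltraFilter F -> F [set y | `|c y| <= M] -> exists p : R, c y @[y --> F] --> p.
Proof.
move=> FU FM.
have [|p [_ clp]] := @segment_compact R (- M) M (c y @[y --> F]) _.
  by rewrite /nbhs/=; apply: filterS FM => y /=; rewrite in_itv/= -ler_norml.
exists p => A /= pA.
have [//|FA] := in_ultra_setVsetC (c @^-1` A) FU.
have [x [/= nAx Ax]] := clp (~` A) A FA pA.
by [].
Qed.

(** Along an ultrafilter the finitely many bounded coefficients converge, so an
    ultrafilter on the images is Cauchy up to e, for every e. *)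
Lemma precompact_finite_rank (V : normedModType R) (B : set V) (K : V -> V) :
  (forall F : set_system V, ProperFilter F -> cauchy F -> cvg F) ->
  (forall e : R, 0 < e -> exists n (c : 'I_n -> V -> R) (phi : 'I_n -> V) (M : R),
     (forall j f, B f -> `|c j f| <= M) /\
     forall f, B f -> `|K f - \sum_j c j f *: phi j| <= e) ->
  precompact (K @` B).
Proof.
move=> complete approx; rewrite precompactE compact_ultra => F FU FS.
have : cauchy F.
  apply/cauchyP => e e0.
  have e4 : 0 < e / 4 by rewrite divr_gt0.
  have [n [c [phi [M [cM Kc]]]]] := approx _ e4.
  (* Compactness concerns the closure of the image: a point y of it is replaced
     by a nearby K (s y) with s y in B, where the coefficients are bounded. *)
  have [s sP] : exists s : V -> V, forall y, closure (K @` B) y ->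
      B (s y) /\ `|K (s y) - y| < e / 4.
    have : forall y, exists f, closure (K @` B) y -> B f /\ `|K f - y| < e / 4.
      move=> y; have [yS|nyS] := pselect (closure (K @` B) y); last by exists 0.
      have [_ [[f Bf <-] /=]] := yS _ (nbhsx_ballx y _ e4).
      by rewrite -ball_normE /= distrC; exists f.
    by move=> /choice [s sP]; exists s => y; exact: sP.
  have [p pP] : exists p : 'I_n -> R, forall j, c j (s y) @[y --> F] --> p j.
    have /choice : forall j, exists p : R, c j (s y) @[y --> F] --> p.
      move=> j; apply: (@ultra_bounded_cvg _ _ _ M) => //.
      by apply: filterS FS => y /sP [By _]; exact: cM.
    by case=> p pP; exists p.
  exists (\sum_j p j *: phi j).
  have : (\sum_j c j (s y) *: phi j) @[y --> F] --> \sum_j p j *: phi j.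
    by apply: cvg_big => [|j _]; [exact: add_continuous|apply: cvgZr_tmp; exact: pP].
  move=> /cvgrPdist_lt /(_ _ e4) H.
  apply: filterS2 H FS => y Hy yS; rewrite -ball_normE /=.
  have [By Ky] := sP _ yS.
  have := Kc _ By => K2.
  have d1 := ler_distD (\sum_j c j (s y) *: phi j) (\sum_j p j *: phi j) y.
  have d2 := ler_distD (K (s y)) (\sum_j c j (s y) *: phi j) y.
  rewrite distrC in K2.
  lra.
move=> /complete /cvg_ex [p Fp]; exists p; split => //.
rewrite (closure_id (closure (K @` B))).1; last exact: closed_closure.
by move=> A /Fp FA; rewrite setIC; exact: filter_ex (filterI FA FS).
Qed.

Lemma bounded_setP (V : normedModType R) (B : set V) :
  bounded_set B <-> exists M : R, forall x, B x -> `|x| <= M.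
Proof.
split=> [|[M BM]]; first by move=> /pinfty_ex_gt0 [M _ ?]; exists M.
by exists M; split => [|N /= MN x /BM xM]; [exact: num_real|exact: le_trans xM (ltW MN)].
Qed.

(** By the resolvent identity, K g = K0 (g + (l0 - l) K g), and g + (l0 - l) K g
    stays in a bounded set when g does. *)
Lemma resolvent_compact_one (V : normedModType R) (D : V -> V -> Prop) (l0 : R)
    (K0 : {linear V -> V}) :
  is_resolvent D l0 K0 -> compact_operator K0 -> resolvent_compact D.
Proof.
move=> K0res K0cpt; split; first by exists l0, K0.
move=> l K [cK KD _] B /bounded_setP[M BM].
have [_ _ K0D] := K0res.
have /(continuous_linear_bounded 0) : {for 0, continuous K} by exact: cK.
move=> /linear_boundedP /pinfty_ex_gt0 [N N0 KN].
apply: (@precompact_subset _ _ (K0 @` [set g + (l0 - l) *: K g | g in B])).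
  move=> _ [g Bg <-]; exists (g + (l0 - l) *: K g); first by exists g.
  have [h Dh hg] := KD g.
  rewrite -[RHS](K0D _ _ Dh); congr (K0 _).
  by rewrite -{1}hg scalerBl addrC addrA subrK.
apply: K0cpt.
apply/bounded_setP; exists (M + `|l0 - l| * (N * M)) => _ [g Bg <-].
apply: le_trans (ler_normD _ _) _; apply: lerD; first exact: BM.
rewrite normrZ ler_wpM2l//; apply: le_trans (KN g) _.
by rewrite ler_wpM2l ?BM// ltW.
Qed.

End compactness.

(** * Completeness of L1 *)

Section L1.
Context d (T : measurableType d) (R : realType).
Variable mu : {measure set T -> \bar R}.
Local Notation L := (LspaceType1 mu).

Lemma L1_normE (x : L) : (`|x|%:E = \int[mu]_t `|x t|%:E)%E.
Proof.
rewrite /Num.norm /= /L1_norm fineK; first by rewrite Lnorm1.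
have := L1_repr_Lfun x; rewrite inE => /andP[_]; rewrite inE /finite_norm /= => ?.
by rewrite ge0_fin_numE// Lnorm_ge0.
Qed.

Lemma L1_norm_fin (x : L) : (\int[mu]_t `|x t|%:E < +oo)%E.
Proof. by rewrite -L1_normE ltry. Qed.

Lemma L1_exists (f : T -> R) : measurable_fun setT f -> (\int[mu]_t `|f t|%:E < +oo)%E ->
  exists x : L, (x : T -> R) = f %[ae mu].
Proof.
move=> mf fi.
have fL : f \in Lfun mu 1%E.
  apply/andP; split; rewrite inE//=.
  by rewrite /finite_norm Lnorm1.
by exists (L1_class (Lfun_Sub (@lexx _ _ 1%E) fL)); exact: L1_classE.
Qed.

Lemma L1_subE (x y : L) : (fun t => (x - y) t) = (fun t => x t - y t) %[ae mu].
Proof.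
have := L1_addE x (- y); have := L1_oppE y.
by apply: filterS2 => t /(_ I) e1 /(_ I) e2 _; rewrite [LHS]e2 e1.
Qed.

Lemma measurable_L1_abs (x : L) : measurable_fun setT (fun t => (`|x t|)%:E).
Proof.
apply/measurable_EFinP; apply: measurableT_comp => //; exact: L1_repr_mfun.
Qed.

Lemma L1_normBE (x y : L) : (`|x - y|%:E = \int[mu]_t `|x t - y t|%:E)%E.
Proof.
rewrite L1_normE; apply: ge0_ae_eq_integral => //.
- exact: measurable_L1_abs.
- apply/measurable_EFinP; apply: measurableT_comp => //.
  by apply: measurable_funB; exact: L1_repr_mfun.
- by have := L1_subE x y; apply: filterS => t + _ => /(_ I) ->.
Qed.

Lemma limn_einf_le (u : (\bar R)^nat) (C : \bar R) n :
  (forall m, (n <= m)%N -> (u m <= C)%E) -> (limn_einf u <= C)%E.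
Proof.
move=> uC; rewrite limn_einf_lim; apply: lime_le; first exact: is_cvg_einfs.
near=> m; apply: le_trans (uC (maxn m n) (leq_maxr _ _)).
by apply: ereal_inf_lbound; exists (maxn m n) => //=; exact: leq_maxl.
Unshelve. all: end_near. Qed.

Lemma limn_einf_ge0 (u : (\bar R)^nat) :
  (forall m, (0 <= u m)%E) -> (0 <= limn_einf u)%E.
Proof.
move=> u0; rewrite limn_einf_lim; apply: lime_ge; first exact: is_cvg_einfs.
by near=> m; apply: le_ereal_inf_tmp => _ [k _ <-].
Unshelve. all: end_near. Qed.

Lemma measurable_limn_einf (u : nat -> T -> \bar R) :
  (forall n, measurable_fun setT (u n)) ->
  measurable_fun setT (fun t => limn_einf (u^~ t)).
Proof.
move=> mu_.
have -> : (fun t => limn_einf (u^~ t)) = (fun t => - limn_esup (fun n => - u n t))%E.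
  by apply/funext => t; rewrite (limn_esupN (u^~ t)) oppeK.
apply: measurableT_comp => //; apply: measurable_fun_limn_esup => n.
exact: measurableT_comp.
Qed.

Lemma cvg_of_summable (u : R^nat) :
  (\sum_(0 <= n <oo) (`|u n.+1 - u n|)%:E < +oo)%E -> cvgn u.
Proof.
move=> s.
have c : cvgn (series (fun n => u n.+1 - u n)).
  by apply: normed_cvg; exact: (@nnseries_is_cvg _ (fun n => `|u n.+1 - u n|)).
have -> : u = (fun n => u 0%N + series (fun n => u n.+1 - u n) n).
  by apply/funext => n; rewrite seriesEnat /= telescope_sumr// addrC subrK.
by apply: is_cvgD => //; exact: is_cvg_cst.
Qed.

(** Riesz-Fischer, for filters: choose points x n within e n = 2^-n of the filter.
    The sum of the |x n.+1 - x n| has a finite integral, so that x n converges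
    almost everywhere, and Fatou's lemma bounds the distance of x n to the
    limit. *)
Lemma L1_cauchy_cvg (F : set_system L) : ProperFilter F -> cauchy F -> cvg F.
Proof.
move=> PF /cauchyP cF.
pose e n : R := (2^-1) ^+ n.
have e0 n : 0 < e n by rewrite exprn_gt0.
have eS n m : (n <= m)%N -> e m <= e n.
  move=> nm; rewrite /e ler_wiXn2l//; lra.
have [x xP] : exists x : nat -> L, forall n, F (ball (x n) (e n)).
  by have /choice [x xP] : forall n, exists y : L, F (ball y (e n)); [by move=> n; exact: cF|exists x].
have xx n m : (n <= m)%N -> `|x n - x m| <= 2 * e n.
  move=> nm; have [y []] := @filter_ex _ _ _ _ (filterI (xP n) (xP m)).
  rewrite -!ball_normE /= => xn xm.
  have := ler_distD y (x n) (x m); rewrite (distrC y).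
  by have := eS _ _ nm; lra.
pose dd n t := (`|x n.+1 t - x n t|)%:E.
have mdd n : measurable_fun setT (dd n).
  apply/measurable_EFinP; apply: measurableT_comp => //.
  by apply: measurable_funB; exact: L1_repr_mfun.
have dd0 n t : (0 <= dd n t)%E by rewrite lee_fin.
have dsum : (\int[mu]_t (\sum_(0 <= n <oo) dd n t) < +oo)%E.
  rewrite integral_nneseries//; apply: (@le_lt_trans _ _ 4%:E); last exact: ltry.
  have d0 n : (0 <= \int[mu]_t dd n t)%E by apply: integral_ge0.
  apply: lime_le; first exact: is_cvg_nneseries.
  near=> n; rewrite (@le_trans _ _ (4 - 4 * e n)%:E)//; last first.
    by rewrite lee_fin gerBl mulr_ge0// ltW.
  elim: (n) => [|k IH]; first by rewrite big_geq// /e expr0 lee_fin mulr1 subrr.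
  rewrite big_nat_recr//= (le_trans (leeD IH (_ : _ <= (2 * e k)%:E)%E))//.
    by rewrite -L1_normBE lee_fin distrC xx.
  by rewrite -EFinD lee_fin /e exprS; lra.
have good : \forall t \ae mu, cvgn (x^~ t).
  have : mu.-integrable setT (fun t => \sum_(0 <= n <oo) dd n t)%E.
    apply/integrableP; split; first by apply: ge0_emeasurable_sum.
    under eq_integral => t _ do rewrite gee0_abs ?nneseries_ge0//.
    exact: dsum.
  move=> /integrable_ae => /(_ measurableT).
  apply: filterS => t /(_ I) /fin_numPlt /andP[_ ?].
  exact: cvg_of_summable.
(* The limsup is measurable everywhere and is the limit wherever there is one. *)
pose g t := fine (limn_esup (fun n => (x n t)%:E)).
have gE t : cvgn (x^~ t) -> x n t @[n --> \oo] --> g t.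
  move=> /cvg_ex [l xl]; suff -> : g t = l by [].
  rewrite /g.
  have /cvg_limn_einf_sup [_ ->//] : (x n t)%:E @[n --> \oo] --> l%:E.
  by apply: cvg_EFin => //; near=> m.
have mg : measurable_fun setT g.
  apply: measurableT_comp => //.
  apply: measurable_fun_limn_esup => n; apply/measurable_EFinP; exact: L1_repr_mfun.
have xg n : (\int[mu]_t `|x n t - g t|%:E <= (2 * e n)%:E)%E.
  have -> : (\int[mu]_t `|x n t - g t|%:E = \int[mu]_t limn_einf (fun m => (`|x n t - x m t|)%:E))%E.
    apply: ge0_ae_eq_integral => //.
    + apply/measurable_EFinP; apply: measurableT_comp => //.
      by apply: measurable_funB => //; exact: L1_repr_mfun.
    + apply: measurable_limn_einf => m; apply/measurable_EFinP.
      apply: measurableT_comp => //.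
      by apply: measurable_funB => //; exact: L1_repr_mfun.
    + by move=> t _; apply: limn_einf_ge0.
    + apply: filterS good => t /gE xgt _.
      have /cvg_limn_einf_sup [-> _//] : (`|x n t - x m t|)%:E @[m --> \oo] --> (`|x n t - g t|)%:E.
      apply: cvg_EFin; first by near=> m.
      apply: cvg_norm; apply: cvgB => //; exact: cvg_cst.
  apply: le_trans (fatou _ _ _ _) _ => //.
  + move=> m; apply/measurable_EFinP; apply: measurableT_comp => //.
    by apply: measurable_funB => //; exact: L1_repr_mfun.
  + apply: (@limn_einf_le _ _ n) => m nm; rewrite -L1_normBE lee_fin; exact: xx.
have [y yg] : exists y : L, (y : T -> R) = g %[ae mu].
  apply: L1_exists => //.
  apply: (@le_lt_trans _ _ (\int[mu]_t ((`|x 0%N t|)%:E + (`|x 0%N t - g t|)%:E))%E).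
    apply: ge0_le_integral => //.
    + by apply/measurable_EFinP; apply: measurableT_comp.
    + apply: emeasurable_funD; first exact: measurable_L1_abs.
      apply/measurable_EFinP; apply: measurableT_comp => //.
      by apply: measurable_funB => //; exact: L1_repr_mfun.
    + move=> t _; rewrite -EFinD lee_fin.
      by have := ler_distD (x 0%N t) 0 (g t); rewrite !sub0r !normrN.
  rewrite ge0_integralD//.
  + rewrite lte_add_pinfty//; first exact: L1_norm_fin.
    exact: le_lt_trans (xg 0%N) (ltry _).
  + exact: measurable_L1_abs.
  + apply/measurable_EFinP; apply: measurableT_comp => //.
    by apply: measurable_funB => //; exact: L1_repr_mfun.
have xy n : `|x n - y| <= 2 * e n.
  rewrite -lee_fin; apply: le_trans (xg n); rewrite L1_normBE.
  rewrite le_eqVlt; apply/orP; left; apply/eqP; apply: ge0_ae_eq_integral => //.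
  - apply/measurable_EFinP; apply: measurableT_comp => //.
    by apply: measurable_funB; exact: L1_repr_mfun.
  - apply/measurable_EFinP; apply: measurableT_comp => //.
    by apply: measurable_funB => //; exact: L1_repr_mfun.
  - by apply: filterS yg => t /(_ I) -> _.
apply/cvg_ex; exists y; apply/cvgrPdist_lt => eps eps0.
(* x n is within 2 e n of y, and the filter is eventually within e n of x n. *)
have [n en] : exists n, 3 * e n < eps.
  have : 3 * e n @[n --> \oo] --> 3 * (0 : R).
    apply: cvgMl_tmp; apply: cvg_expr; rewrite ger0_norm//; lra.
  rewrite mulr0 => /cvgrPdist_lt /(_ _ eps0) [n _ /(_ n (leqnn _))] /=.
  rewrite sub0r normrN => H; exists n; exact: le_lt_trans (ler_norm _) H.
apply: filterS (xP n) => z; rewrite -ball_normE /= => xz.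
apply: le_lt_trans (ler_distD (x n) _ _) _; rewrite distrC.
apply: le_lt_trans (lerD (xy n) (ltW xz)) _.
by move: en; lra.
Unshelve. all: end_near. Qed.
End L1.

(** * Integrals on the real line *)

Section line.
Context {R : realType}.
Local Notation leb := (@lebesgue_measure R).

Lemma integral_translate (t : R) (f : R -> \bar R) :
  measurable_fun setT f -> (forall x, 0 <= f x)%E ->
  (\int[leb]_x f (x + t)%R = \int[leb]_x f x)%E.
Proof.
move=> mf f0.
have mt : measurable_fun setT ((fun x : R => x + t)%R : R -> measurableTypeR R).
  by apply: measurable_funD.
transitivity (\int[pushforward leb ((fun x : R => x + t)%R : R -> measurableTypeR R)]_x f x)%E.
  by rewrite ge0_integral_pushforward.
apply: eq_measure_integral => //= A mA _; apply/esym/lebesgue_measure_unique => //=.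
move=> _ [[p q]] _ <-; rewrite /pushforward /=.
rewrite (_ : _ @^-1` _ = `]p - t, q - t]%classic).
  rewrite !lebesgue_measure_itv /= !lte_fin ltrD2r.
  by case: ifP => // _; rewrite -!EFinB; congr EFin; lra.
by apply/seteqP; split => x /=; rewrite !in_itv/= ltrBlDr lerBrDr.
Qed.

Lemma integral_reflect (u : R) (f : R -> \bar R) :
  measurable_fun setT f -> (forall x, 0 <= f x)%E ->
  (\int[leb]_x f (u - x)%R = \int[leb]_x f x)%E.
Proof.
move=> mf f0.
rewrite -[RHS](integral_translate u)//.
have mt : measurable_fun setT (fun x : R => f (x + u)%R).
  by apply: measurableT_comp => //; apply: measurable_funD.
transitivity (\int[pushforward leb (-%R : R -> measurableTypeR R)]_x f (x + u)%R)%E.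
  rewrite ge0_integral_pushforward//=.
  rewrite preimage_setT; apply: eq_integral => x _ /=.
  by rewrite addrC.
by apply: eq_measure_integral => //= A mA _; exact: lebesgue_measureN.
Qed.

End line.

Section density.
Import HBNNSimple.
Context (R : realType).
Local Notation m := (@lebesgue_measure R).
Variables (mu : {measure set R -> \bar R}) (D : set R) (w : R -> R).
Hypotheses (mD : measurable D) (mw : measurable_fun D w).
Hypothesis w0 : forall x, D x -> 0 <= w x.
Hypothesis muE : forall A, measurable A ->
  mu A = (\int[m]_(x in A `&` D) (w x)%:E)%E.

(** By definition of mu for indicators, then by linearity and monotone convergence
    along an approximation of f by simple functions. *)
Lemma integral_density (f : R -> R) :
  measurable_fun setT f -> (forall x, 0 <= f x) ->
  (\int[mu]_x (f x)%:E = \int[m]_(x in D) (f x * w x)%:E)%E.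
Proof.
move=> mf f0.
have mf' : measurable_fun setT (EFin \o f) by exact/measurable_EFinP.
pose g := nnsfun_approx measurableT mf'.
have mg n : measurable_fun setT (g n) by [].
have gf x : (g n x)%:E @[n --> \oo] --> (f x)%:E.
  by apply: (@cvg_nnsfun_approx _ _ _ _ measurableT _ mf') => // y _; rewrite lee_fin.
have gnd x n k : (n <= k)%N -> g n x <= g k x.
  by move=> nk; exact/lefP/nd_nnsfun_approx.
transitivity (limn (fun n => \int[mu]_x (g n x)%:E)%E).
  rewrite -monotone_convergence//.
  - by apply: eq_integral => x _; apply/esym/cvg_lim => //; exact: gf.
  - by move=> n; exact/measurable_EFinP.
  - by move=> n x _; rewrite lee_fin.
  - by move=> x _ n k nk; rewrite lee_fin gnd.
transitivity (limn (fun n => \int[m]_(x in D) (g n x * w x)%:E)%E); last first.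
  rewrite -monotone_convergence//.
  - apply: eq_integral => x _; apply/cvg_lim => //.
    under eq_fun do rewrite EFinM; rewrite EFinM; apply: cvgeZr => //; exact: gf.
  - move=> n; apply/measurable_EFinP; apply: measurable_funM => //.
    exact: measurable_funTS (mg n).
  - by move=> n x Dx; rewrite lee_fin mulr_ge0// w0.
  - by move=> x Dx n k nk; rewrite lee_fin ler_wpM2r ?gnd ?w0.
congr (limn _); apply/funext => n.
have mI v : measurable_fun setT (\1_(g n @^-1` [set v]) : R -> R).
  by apply: measurable_indic.
have vA v x : 0 <= v * \1_(g n @^-1` [set v]) x.
  rewrite indicE; have [|] := boolP (x \in _); last by rewrite mulr0.
  by rewrite inE/= => <-; rewrite mulr1.
have -> : (\int[m]_(x in D) (g n x * w x)%:E = \int[m]_(x in D)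
    (\sum_(v \in range (g n)) (v * \1_(g n @^-1` [set v]) x * w x)%:E)%R)%E.
  apply: eq_integral => x _; rewrite fsumEFin//.
  by congr EFin; rewrite {1}fimfunE mulr_fsuml.
have -> : (\int[mu]_x (g n x)%:E = \int[mu]_x
    (\sum_(v \in range (g n)) (v * \1_(g n @^-1` [set v]) x)%:E)%R)%E.
  apply: eq_integral => x _; rewrite fsumEFin//.
  by congr EFin; rewrite {1}fimfunE.
rewrite !ge0_integral_fsum//; last 4 first.
- move=> v; apply/measurable_EFinP; apply: measurable_funM => //.
  by apply: measurable_funM => //; exact: measurable_funTS (mI v).
- by move=> v x Dx; rewrite lee_fin mulr_ge0 ?w0.
- by move=> v; apply/measurable_EFinP; apply: measurable_funM.
- by move=> v x _; rewrite lee_fin vA.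
apply: eq_fsbigr => v /set_mem vr.
have v0 : 0 <= v by case: vr => x _ <-.
transitivity (v%:E * mu (g n @^-1` [set v]))%E.
  under eq_integral do rewrite EFinM.
  by rewrite ge0_integralZl//; [rewrite integral_indic// setIT|exact/measurable_EFinP].
rewrite muE// integral_mkcondl -ge0_integralZl//; last 2 first.
- rewrite epatch_indic; apply: emeasurable_funM; first exact/measurable_EFinP.
  by apply/measurable_EFinP; exact: measurable_funTS (mI v).
- by move=> x Dx; rewrite /patch; case: ifP => // _; rewrite lee_fin w0.
apply: eq_integral => x _; rewrite /patch indicE.
by case: ifPn => _; rewrite ?mulr1 ?mulr0 ?mul0r ?EFinM ?mule0.
Qed.

End density.

Section primitive.
Context {R : realType}.
Local Notation leb := (@lebesgue_measure R).
Variables (D : set R) (b : R -> R) (c : R).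
Hypotheses (Ditv : is_interval D) (Dc : D c).
Hypothesis bI : forall s u, D s -> D u -> leb.-integrable `[s, u] (EFin \o b).

(** The domain D is a parameter because primitives are needed both on the line,
    for the absorption, and on ]0, +oo[, for 1/r. *)
Definition primitive (u : R) : R :=
  if c <= u then \int[leb]_(x in `]c, u]) b x else - \int[leb]_(x in `]u, c]) b x.

Lemma integrable_oc s u : D s -> D u -> leb.-integrable `]s, u] (EFin \o b).
Proof.
move=> Ds Du; apply: (integrableS _ _ _ (bI Ds Du)) => //.
exact: subset_itv_oc_cc.
Qed.

Lemma Rintegral_chasles x y z : D x -> D z -> x <= y -> y <= z ->
  \int[leb]_(t in `]x, z]) b t = \int[leb]_(t in `]x, y]) b t + \int[leb]_(t in `]y, z]) b t.
Proof.
move=> Dx Dz xy yz.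
rewrite -(@Rintegral_itvB _ _ (BRight x) (BRight z) y) ?bnd_simp//; last exact: integrable_oc.
by rewrite addrC subrK.
Qed.

Lemma primitiveB s u : D s -> D u -> s <= u ->
  primitive u - primitive s = \int[leb]_(x in `]s, u]) b x.
Proof.
move=> Ds Du su; rewrite /primitive.
have [cs|sc] := leP c s.
  by rewrite (le_trans cs su) (Rintegral_chasles Dc Du cs su) addrC addKr.
have [cu|uc] := leP c u.
  by rewrite opprK (Rintegral_chasles Ds Du (ltW sc) cu) addrC.
by rewrite (Rintegral_chasles Ds Dc su (ltW uc)) opprK addrC addrK.
Qed.

Hypothesis b0 : forall x, D x -> 0 <= b x.

Lemma primitive_nd s u : D s -> D u -> s <= u -> primitive s <= primitive u.
Proof.
move=> Ds Du su; rewrite -subr_ge0 primitiveB//; apply: Rintegral_ge0 => x.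
rewrite /= in_itv/= => /andP[sx xu]; apply: b0; apply: (Ditv Ds Du).
by rewrite (ltW sx) xu.
Qed.

Lemma primitiveE s u : D s -> D u -> s <= u ->
  ((primitive u - primitive s)%:E = \int[leb]_(x in `[s, u]) (b x)%:E)%E.
Proof.
move=> Ds Du su; rewrite primitiveB// Rintegral_itv_obnd_cbnd; last exact: integrable_oc.
by rewrite /Rintegral fineK// integrable_fin_num//; exact: bI.
Qed.

Lemma primitive_continuous s u : D s -> D u -> s <= u ->
  {within `[s, u], continuous primitive}.
Proof.
move=> Ds Du su.
have := @parameterized_integral_continuous R s u b su (bI Ds Du).
move=> pc.
have : {within `[s, u], continuous (fun x => primitive s + parameterized_integral leb s x b)}.
  move=> x; apply: cvgD; [exact: cvg_cst|exact: pc].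
apply: subspace_eq_continuous => x /set_mem /=; rewrite in_itv/= => /andP[sx xu].
have Dx : D x by apply: (Ditv Ds Du); rewrite sx xu.
rewrite /from_subspace /= /parameterized_integral.
by rewrite -Rintegral_itv_obnd_cbnd ?integrable_oc// -primitiveB// addrC subrK.
Qed.

End primitive.

Section bigcup_bound.
Context {R : realType}.
Local Notation leb := (@lebesgue_measure R).

Lemma integral_bigcup_le (F : (set R)^nat) (f : R -> R) (M : \bar R) :
  (forall n m, (n <= m)%N -> F n `<=` F m) -> (forall n, measurable (F n)) ->
  (forall n, measurable_fun (F n) f) -> (forall n x, F n x -> 0 <= f x) ->
  (forall n, \int[leb]_(x in F n) (f x)%:E <= M)%E ->
  (\int[leb]_(x in \bigcup_n F n) (f x)%:E <= M)%E.
Proof.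
move=> ndF mF mf f0 H.
have ndF' : {homo F : n m / (n <= m)%N >-> (n <= m)%O}.
  by move=> n m nm; apply/subsetPset; exact: ndF.
have mfe n : measurable_fun (F n) (EFin \o f) by exact/measurable_EFinP.
have fe0 n x : F n x -> (0 <= (EFin \o f) x)%E by move=> Fx; rewrite lee_fin (f0 n).
have cv := @ge0_nondecreasing_set_cvg_integral _ (measurableTypeR R) R F (EFin \o f) leb
  ndF' mF mfe fe0.
have nd := @ge0_nondecreasing_set_nondecreasing_integral _ (measurableTypeR R) R F (EFin \o f) leb
  ndF' mF mfe fe0.
rewrite -(cvg_lim _ cv)//; apply: lime_le; last by near=> n; exact: H.
exact: ereal_nondecreasing_is_cvgn.
Unshelve. all: end_near. Qed.

End bigcup_bound.

(** * Decay of exp (- B) against the derivative of B *)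

Section exp_decay.
Context {R : realType}.
Local Notation leb := (@lebesgue_measure R).
Variables (b B : R -> R).
Hypotheses (mb : measurable_fun setT b) (b0 : forall u, 0 <= b u).
Hypothesis BE : forall s u, s <= u ->
  ((B u - B s)%:E = \int[leb]_(x in `[s, u]) (b x)%:E)%E.
Hypothesis cB : continuous B.

Let B_nondecreasing s u : s <= u -> B s <= B u.
Proof.
move=> su; rewrite -subr_ge0 -lee_fin BE//.
by apply: integral_ge0 => x _; rewrite lee_fin.
Qed.

Let measurable_B : measurable_fun setT B.
Proof. exact: continuous_measurable_fun. Qed.

Lemma expRN_le_quad (x : R) : 0 <= x -> expR (- x) <= 1 - x + x ^+ 2.
Proof.
move=> x0; rewrite expRN; apply: (@le_trans _ _ (1 + x)^-1).
  by rewrite lef_pV2 ?posrE ?expR_gt0 ?expR_ge1Dx//; lra.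
rewrite -[leLHS]div1r ler_pdivrMr; last by lra.
have : 0 <= x ^+ 3 by rewrite exprn_ge0.
nra.
Qed.

Let g s u := b u * expR (- (B u - B s)).

Let g_ge0 s u : 0 <= g s u.
Proof. by rewrite mulr_ge0// expR_ge0. Qed.

Let measurable_g s : measurable_fun setT (g s).
Proof.
apply: measurable_funM => //; apply: measurableT_comp => //.
by apply: measurableT_comp => //; apply: measurable_funB => //; exact: measurable_B.
Qed.

(** The substitution v = B u would give 1 - e^{-(B q - B s)} exactly, but b is only
    locally integrable.  Instead [s, q] is cut into k pieces on which B grows by
    at most eta; there the exponential is replaced by its value at the left end,
    which costs at most eta^2 because x <= 1 - e^{-x} + x^2. *)
Lemma exp_decay_step (s eta : R) (k : nat) (q : R) : 0 <= eta -> s <= q ->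
  B q - B s <= k%:R * eta ->
  (\int[leb]_(u in `[s, q]) (g s u)%:E <=
    (1 - expR (- (B q - B s)) + k%:R * eta ^+ 2)%:E)%E.
Proof.
move=> eta0; elim: k q => [|k IH] q sq Bq.
  have Bsq : B q - B s = 0.
    by apply/eqP; rewrite eq_le subr_ge0 B_nondecreasing// andbT; rewrite mul0r in Bq.
  rewrite Bsq oppr0 expR0 subrr mul0r addr0.
  apply: (@le_trans _ _ (\int[leb]_(x in `[s, q]) (b x)%:E)%E); last first.
    by rewrite -BE// Bsq.
  apply: ge0_le_integral => //.
  - by move=> x _; rewrite lee_fin g_ge0.
  - by apply/measurable_EFinP; apply: measurable_funTS; exact: measurable_g.
  - by apply/measurable_EFinP; apply: measurable_funTS.
  - move=> x /=; rewrite in_itv/= => /andP[sx xq]; rewrite lee_fin ler_piMr//.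
    by rewrite -expR0 ler_expR oppr_le0 subr_ge0 B_nondecreasing.
(* ]p, q] is the last piece: B grows by eta on it, or by B q - B s if that is
   less. *)
have [p /[!in_itv]/= /andP[sp pq] Bp] : exists2 p, p \in `[s, q] & B p = Num.max (B s) (B q - eta).
  apply: IVT => //; first by apply: continuous_subspaceT.
  have Bsq := B_nondecreasing sq.
  rewrite (min_idPl Bsq) (max_idPr Bsq) le_max lexx /= ge_max Bsq /=; lra.
have Bsq := B_nondecreasing sq; have Bsp := B_nondecreasing sp; have Bpq := B_nondecreasing pq.
have Bqp : B q - B p <= eta.
  by rewrite lerBlDr -lerBlDl Bp le_max lexx orbT.
have Bps : B p - B s <= k%:R * eta.
  rewrite Bp; have [_|_] := leP (B s) (B q - eta).
    by move: Bq; rewrite -natr1 mulrDl mul1r; lra.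
  by rewrite subrr mulr_ge0.
have -> : `[s, q]%classic = `[s, p]%classic `|` `]p, q]%classic.
  by rewrite -itv_bndbnd_setU// bnd_simp.
rewrite ge0_integral_setU//=; last 3 first.
- by apply/measurable_EFinP; apply: measurable_funTS; exact: measurable_g.
- by move=> x _; rewrite lee_fin g_ge0.
- apply/disj_setPRL => x /=; rewrite !in_itv/= => /andP[px xq].
  by apply/negP; rewrite negb_and -!ltNge px orbT.
apply: (@le_trans _ _ ((1 - expR (- (B p - B s)) + k%:R * eta ^+ 2)%:E +
    (expR (- (B p - B s)) * (B q - B p))%:E)%E); first (apply: leeD; first exact: IH).
  rewrite EFinM BE// -ge0_integralZl ?lee_fin ?expR_ge0//; last 2 first.
  - by apply/measurable_EFinP; exact: measurable_funTS.
  - by move=> x _; rewrite lee_fin.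
  apply: (@le_trans _ _ (\int[leb]_(u in `[p, q]) (g s u)%:E)%E).
    apply: ge0_subset_integral => //.
    - by apply/measurable_EFinP; apply: measurable_funTS; exact: measurable_g.
    - by move=> x _; rewrite lee_fin g_ge0.
    - exact: subset_itv_oc_cc.
  apply: ge0_le_integral => //.
  - by move=> x _; rewrite lee_fin g_ge0.
  - by apply/measurable_EFinP; apply: measurable_funTS; exact: measurable_g.
  - by apply/measurable_EFinP; apply: measurable_funTS; apply: measurable_funM.
  - move=> x /=; rewrite in_itv/= => /andP[sx xq]; rewrite -EFinM lee_fin /g mulrC ler_wpM2r//.
    by rewrite ler_expR lerN2 lerD2r B_nondecreasing.
rewrite -EFinD lee_fin -natr1.
set E := expR (- (B p - B s)).
have -> : expR (- (B q - B s)) = E * expR (- (B q - B p)).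
  by rewrite -expRD; congr expR; lra.
have E1 : E <= 1 by rewrite -expR0 ler_expR; lra.
have E0 : 0 <= E by rewrite expR_ge0.
have x0 : 0 <= B q - B p by lra.
have := expRN_le_quad x0.
set x := B q - B p in Bqp x0 *; set ex := expR (- x) => exq.
have xx : x ^+ 2 <= eta ^+ 2 by rewrite ler_sqr.
have : E * (ex - 1 + x) <= E * x ^+ 2 by rewrite ler_wpM2l//; lra.
have : E * x ^+ 2 <= 1 * eta ^+ 2.
  by rewrite ler_pM// sqr_ge0.
rewrite mulrDl; lra.
Qed.

Lemma exp_decay_bounded (s q : R) : s <= q ->
  (\int[leb]_(u in `[s, q]) (g s u)%:E <= 1)%E.
Proof.
move=> sq; apply/lee_addgt0Pr => e e0.
have L0 : 0 <= B q - B s by rewrite subr_ge0 B_nondecreasing.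
set L := B q - B s in L0.
(* With n pieces of growth L / n, the total error is n (L / n)^2 = L^2 / n. *)
pose n := (Num.truncn (L ^+ 2 / e)).+1.
have n0 : 0 < n%:R :> R by rewrite ltr0n.
have Ln : L ^+ 2 / n%:R <= e.
  rewrite ler_pdivrMr// mulrC -ler_pdivrMr//.
  apply: ltW; exact: truncnS_gt.
apply: le_trans (@exp_decay_step s (L / n%:R) n q _ sq _) _.
- by rewrite divr_ge0// ltW.
- by rewrite mulrC divfK// gt_eqF.
- rewrite -EFinD lee_fin.
  have -> : n%:R * (L / n%:R) ^+ 2 = L ^+ 2 / n%:R.
    by field; rewrite gt_eqF.
  have := expR_ge0 (- (B q - B s)); lra.
Qed.

Lemma exp_decay (s : R) :
  (\int[leb]_(u in `[s, +oo[) (b u * expR (- (B u - B s)))%:E <= 1)%E.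
Proof.
rewrite itv_bndy_bigcup_BRight; apply: (@integral_bigcup_le _ _ (g s)).
- move=> n m nm x /=; rewrite !in_itv/= => /andP[-> /le_trans]; apply.
  by rewrite lerD2l ler_nat.
- by move=> n; exact: measurable_itv.
- by move=> n; apply: measurable_funTS; exact: measurable_g.
- by move=> n x _; exact: g_ge0.
- by move=> n; apply: exp_decay_bounded; rewrite lerDl.
Qed.

End exp_decay.

Section Rintegral_subst.
Context {R : realType}.
Local Notation leb := (@lebesgue_measure R).

Lemma Rintegral_translate (t : R) (f : R -> R) : measurable_fun setT f ->
  \int[leb]_x f (x + t) = \int[leb]_x f x.
Proof.
move=> mf; rewrite /Rintegral; congr fine.
have mf' : measurable_fun setT (EFin \o f) by exact/measurable_EFinP.
rewrite integralE [RHS]integralE; congr (_ - _)%E.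
- rewrite -[RHS](@integral_translate _ t _ (measurable_funepos mf') (funepos_ge0 _)).
  by apply: eq_integral => x _; rewrite !funeposE.
- rewrite -[RHS](@integral_translate _ t _ (measurable_funeneg mf') (funeneg_ge0 _)).
  by apply: eq_integral => x _; rewrite !funenegE.
Qed.

Lemma Rintegral_reflect (u : R) (f : R -> R) : measurable_fun setT f ->
  \int[leb]_x f (u - x) = \int[leb]_x f x.
Proof.
move=> mf; rewrite /Rintegral; congr fine.
have mf' : measurable_fun setT (EFin \o f) by exact/measurable_EFinP.
rewrite integralE [RHS]integralE; congr (_ - _)%E.
- rewrite -[RHS](@integral_reflect _ u _ (measurable_funepos mf') (funepos_ge0 _)).
  by apply: eq_integral => x _; rewrite !funeposE.
- rewrite -[RHS](@integral_reflect _ u _ (measurable_funeneg mf') (funeneg_ge0 _)).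
  by apply: eq_integral => x _; rewrite !funenegE.
Qed.

Lemma measurable_param_Rintegral (g : R -> R -> R) :
  measurable_fun setT (fun z : R * R => g z.1 z.2) ->
  measurable_fun setT (fun u => \int[leb]_s g s u).
Proof.
move=> mg; apply: measurableT_comp => //.
have mg' : measurable_fun setT (EFin \o (fun z : R * R => g z.1 z.2)) by exact/measurable_EFinP.
under eq_fun do rewrite integralE.
apply: emeasurable_funB.
- pose h := funepos (EFin \o (fun z : R * R => g z.1 z.2)).
  have := @measurable_fun_fubini_tonelli_G _ _ (measurableTypeR R) (measurableTypeR R) _ leb h
    (measurable_funepos mg') (funepos_ge0 _).
  congr (measurable_fun _ _); apply/funext => u.
  by apply: eq_integral => s _; rewrite /h !funeposE.
- pose h := funeneg (EFin \o (fun z : R * R => g z.1 z.2)).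
  have := @measurable_fun_fubini_tonelli_G _ _ (measurableTypeR R) (measurableTypeR R) _ leb h
    (measurable_funeneg mg') (funeneg_ge0 _).
  congr (measurable_fun _ _); apply/funext => u.
  by apply: eq_integral => s _; rewrite /h !funenegE.
Qed.

Lemma tonelli_R (g : R -> R -> R) :
  measurable_fun setT (fun z : R * R => g z.1 z.2) -> (forall s u, 0 <= g s u) ->
  (\int[leb]_u \int[leb]_s (g s u)%:E = \int[leb]_s \int[leb]_u (g s u)%:E)%E.
Proof.
move=> mg g0.
have mg' : measurable_fun setT (EFin \o (fun z : R * R => g z.1 z.2)) by exact/measurable_EFinP.
have := @fubini_tonelli _ _ (measurableTypeR R) (measurableTypeR R) _ leb leb _ mg'.
by move=> -> // z; rewrite lee_fin.
Qed.

End Rintegral_subst.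

(** * Nonnegative and absolutely convergent Lebesgue integrals *)

Section leb_helpers.
Context {R : realType}.
Local Notation leb := (@lebesgue_measure R).
Implicit Types f g : R -> R.

Lemma ge0_le_leb f g : measurable_fun setT f -> measurable_fun setT g ->
  (forall x, 0 <= f x) -> (forall x, f x <= g x) ->
  (\int[leb]_x (f x)%:E <= \int[leb]_x (g x)%:E)%E.
Proof.
move=> mf mg f0 fg; apply: ge0_le_integral => //.
- by move=> x _; rewrite lee_fin.
- exact/measurable_EFinP.
- exact/measurable_EFinP.
- by move=> x _; rewrite lee_fin.
Qed.

Lemma ge0_le_lebe f (g : R -> \bar R) : measurable_fun setT f -> measurable_fun setT g ->
  (forall x, 0 <= f x) -> (forall x, (f x)%:E <= g x)%E ->
  (\int[leb]_x (f x)%:E <= \int[leb]_x g x)%E.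
Proof.
move=> mf mg f0 fg; apply: ge0_le_integral => //.
- by move=> x _; rewrite lee_fin.
- exact/measurable_EFinP.
Qed.

Lemma ge0_lebe_le f (g : R -> \bar R) : measurable_fun setT f -> measurable_fun setT g ->
  (forall x, (0 <= g x)%E) -> (forall x, g x <= (f x)%:E)%E ->
  (\int[leb]_x g x <= \int[leb]_x (f x)%:E)%E.
Proof.
move=> mf mg f0 fg; apply: ge0_le_integral => //.
exact/measurable_EFinP.
Qed.

Lemma ge0_lebZl (c : R) f : measurable_fun setT f -> (forall x, 0 <= f x) -> 0 <= c ->
  (\int[leb]_x (c * f x)%:E = c%:E * \int[leb]_x (f x)%:E)%E.
Proof.
move=> mf f0 c0; under eq_integral do rewrite EFinM.
rewrite ge0_integralZl// ?lee_fin//; last by move=> x _; rewrite lee_fin.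
exact/measurable_EFinP.
Qed.

Lemma ge0_lebD f g : measurable_fun setT f -> measurable_fun setT g ->
  (forall x, 0 <= f x) -> (forall x, 0 <= g x) ->
  (\int[leb]_x (f x + g x)%:E = \int[leb]_x (f x)%:E + \int[leb]_x (g x)%:E)%E.
Proof.
move=> mf mg f0 g0; under eq_integral do rewrite EFinD.
rewrite ge0_integralD//.
- by move=> x _; rewrite lee_fin.
- exact/measurable_EFinP.
- by move=> x _; rewrite lee_fin.
- exact/measurable_EFinP.
Qed.

Lemma leb_integrable_le f g : measurable_fun setT f -> measurable_fun setT g ->
  (forall x, `|f x| <= g x) -> (\int[leb]_x (g x)%:E < +oo)%E ->
  leb.-integrable setT (EFin \o f).
Proof.
move=> mf mg fg gi; apply/integrableP; split; first exact/measurable_EFinP.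
apply: le_lt_trans gi; apply: ge0_le_leb => //; exact: measurableT_comp.
Qed.

Lemma leb_integrable_abs f g : measurable_fun setT f ->
  (forall x, `|f x| <= `|g x|) -> leb.-integrable setT (EFin \o g) ->
  leb.-integrable setT (EFin \o f).
Proof.
move=> mf fg /integrableP[/measurable_EFinP mg gi].
by apply: (leb_integrable_le mf _ fg) => //; exact: measurableT_comp.
Qed.

Lemma leb_integrableZl (c : R) f : leb.-integrable setT (EFin \o f) ->
  leb.-integrable setT (EFin \o (fun x => c * f x)).
Proof. by move=> fi; have := integrableZl measurableT c fi. Qed.

Lemma abs_Rintegral f : leb.-integrable setT (EFin \o f) ->
  (`|\int[leb]_s f s|%:E <= \int[leb]_s (`|f s|)%:E)%E.
Proof.
move=> fi; rewrite EFin_normr_Rintegral//; apply: le_abse_integral => //.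
by case/integrableP : fi.
Qed.

Lemma measurable_param_integral (g : R -> R -> R) :
  measurable_fun setT (fun z : R * R => g z.1 z.2) -> (forall s u, 0 <= g s u) ->
  measurable_fun setT (fun u => \int[leb]_s (g s u)%:E)%E.
Proof.
move=> mg g0.
have mg' : measurable_fun setT (EFin \o (fun z : R * R => g z.1 z.2)) by exact/measurable_EFinP.
have := @measurable_fun_fubini_tonelli_G _ _ (measurableTypeR R) (measurableTypeR R) _ leb _ mg'.
by apply => z; rewrite lee_fin.
Qed.

Lemma measurable_param_integral' (g : R -> R -> R) :
  measurable_fun setT (fun z : R * R => g z.1 z.2) -> (forall s u, 0 <= g s u) ->
  measurable_fun setT (fun s => \int[leb]_u (g s u)%:E)%E.
Proof.
move=> mg g0.
have mg' : measurable_fun setT (EFin \o (fun z : R * R => g z.1 z.2)) by exact/measurable_EFinP.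
have := @measurable_fun_fubini_tonelli_F _ _ (measurableTypeR R) (measurableTypeR R) _ leb _ mg'.
by apply => z; rewrite lee_fin.
Qed.

End leb_helpers.

(** * Damped translations of the line and their resolvent *)

Section damped.
Context {R : realType}.
Local Notation leb := (@lebesgue_measure R).
Variables (A W : R -> R) (om : R).
Hypotheses (mA : measurable_fun setT A) (A0 : forall u, 0 <= A u).
Hypothesis Aint : forall s u : R, leb.-integrable `[s, u] (EFin \o A).
Hypotheses (mW : measurable_fun setT W) (W0 : forall u, 0 < W u).
Hypothesis Wexp : forall s u : R, s <= u -> W u <= expR (om * (u - s)) * W s.

(** A is the absorption seen along the flow; damping, written P below, is the
    total absorption since time 0. *)
Definition damping : R -> R := primitive A 0.
Local Notation P := damping.

Lemma dampingE s u : s <= u -> ((P u - P s)%:E = \int[leb]_(x in `[s, u]) (A x)%:E)%E.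
Proof. by move=> su; apply: (@primitiveE _ setT). Qed.

Lemma damping_nd s u : s <= u -> P s <= P u.
Proof. by move=> su; apply: (@primitive_nd _ setT). Qed.

Lemma damping_continuous : continuous P.
Proof.
move=> x.
have xx : x - 1 < x + 1 by lra.
have /(continuous_within_itvP _ xx)[H _ _] : {within `[x - 1, x + 1], continuous P}.
  by apply: (@primitive_continuous _ setT) => //; exact: ltW.
by apply: H; rewrite in_itv/=; lra.
Qed.

Lemma measurable_damping : measurable_fun setT P.
Proof. exact: continuous_measurable_fun damping_continuous. Qed.

(* Once the growth rate om of the weight is taken off the resolvent parameter
   om + 1, the decay rate 1 + A remains. *)
Let b u := 1 + A u.
Let B u := u + P u.

Lemma BE s u : s <= u -> ((B u - B s)%:E = \int[leb]_(x in `[s, u]) (b x)%:E)%E.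
Proof.
move=> su; under eq_integral do rewrite EFinD.
rewrite ge0_integralD//=; last 2 first.
- by move=> x _; rewrite lee_fin.
- by apply/measurable_EFinP; apply: measurable_funTS.
rewrite -dampingE// integral_cst//= mul1e lebesgue_measure_itv/= lte_fin.
have [su'|] := ltP s u; first by rewrite -EFinB -EFinD /B; congr EFin; lra.
move=> us; have -> : u = s by apply/eqP; rewrite eq_le us su.
by rewrite add0e !subrr.
Qed.

Lemma B_continuous : continuous B.
Proof. by move=> x; apply: cvgD; [exact: cvg_id|exact: damping_continuous]. Qed.

Definition potential (u : R) : R := (om + 1) * u + P u.

(** The Green function of om + 1 + d/du + A; the damped translations have the
    generator - (d/du + A). *)
Definition green (s u : R) : R := if s <= u then expR (potential s - potential u) else 0.

Definition wnorm (F : R -> R) : \bar R := (\int[leb]_u (`|F u| * W u)%:E)%E.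

(** The resolvent of the damped translations at om + 1: the Laplace transform of
    damped_shift tau F, after the substitution s = u - tau. *)
Definition green_op (F : R -> R) u := \int[leb]_s (green s u * F s).

Definition damped_shift t (F : R -> R) u := expR (- (P u - P (u - t))) * F (u - t).

Lemma measurable_potential : measurable_fun setT potential.
Proof.
by apply: measurable_funD; [apply: measurable_funM|exact: measurable_damping].
Qed.

Lemma measurable_B : measurable_fun setT B.
Proof. by apply: measurable_funD => //; exact: measurable_damping. Qed.

Lemma green_ge0 s u : 0 <= green s u.
Proof. by rewrite /green; case: ifP => // _; exact: expR_ge0. Qed.

Let E (s u : R) : R := if s <= u then expR (- (B u - B s)) else 0.

Lemma E_ge0 s u : 0 <= E s u.
Proof. by rewrite /E; case: ifP => // _; exact: expR_ge0. Qed.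

Lemma E_le1 s u : E s u <= 1.
Proof.
rewrite /E; case: ifP => // su; rewrite -expR0 ler_expR oppr_le0 /B.
by have := damping_nd su; lra.
Qed.

(** The growth of W between s and u is absorbed by the part om of the parameter
    om + 1. *)
Lemma green_weight s u : green s u * W u <= E s u * W s.
Proof.
rewrite /green /E; case: ifP => su; last by rewrite !mul0r.
apply: (@le_trans _ _ (expR (potential s - potential u) * (expR (om * (u - s)) * W s))).
  by rewrite ler_wpM2l ?expR_ge0 ?Wexp.
rewrite mulrA -expRD le_eqVlt; apply/orP; left; apply/eqP; congr (expR _ * _).
by rewrite /potential /B; ring.
Qed.

Lemma green_weight1 s u : green s u * W u <= W s.
Proof. by apply: le_trans (green_weight s u) _; rewrite ler_piMl ?E_le1// ltW. Qed.

Lemma measurable_green2 : measurable_fun setT (fun z : R * R => green z.1 z.2).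
Proof.
apply: measurable_fun_ifT => //; first exact: measurable_fun_ler.
apply: measurableT_comp => //; apply: measurable_funB.
  exact: (measurableT_comp measurable_potential).
exact: (measurableT_comp measurable_potential).
Qed.

Lemma measurable_E2 : measurable_fun setT (fun z : R * R => E z.1 z.2).
Proof.
apply: measurable_fun_ifT => //; first exact: measurable_fun_ler.
apply: measurableT_comp => //; apply: measurableT_comp => //; apply: measurable_funB.
  exact: (measurableT_comp measurable_B).
exact: (measurableT_comp measurable_B).
Qed.

Lemma measurable_green1 u : measurable_fun setT (green^~ u).
Proof.
apply: measurable_fun_ifT => //; first exact: measurable_fun_ler.
by apply: measurableT_comp => //; apply: measurable_funB => //; exact: measurable_potential.
Qed.

Lemma measurable_E1 u : measurable_fun setT (E^~ u).
Proof.
apply: measurable_fun_ifT => //; first exact: measurable_fun_ler.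
apply: measurableT_comp => //; apply: measurableT_comp => //.
by apply: measurable_funB => //; exact: measurable_B.
Qed.

Lemma expR_mulA (x y z t f : R) : x + y = z + t ->
  expR x * (expR y * f) = expR z * (expR t * f).
Proof. by move=> xyzt; rewrite !mulrA -!expRD xyzt. Qed.

Section fixed_source.
Variable F : R -> R.
Hypotheses (mF : measurable_fun setT F) (FW : (wnorm F < +oo)%E).

Let mFn : measurable_fun setT (fun s => `|F s|).
Proof. exact: measurableT_comp. Qed.

Let mFW : measurable_fun setT (fun s => `|F s| * W s).
Proof. exact: measurable_funM. Qed.

Let FW0 s : 0 <= `|F s| * W s.
Proof. by rewrite mulr_ge0// ltW. Qed.

Lemma measurable_green_op : measurable_fun setT (green_op F).
Proof.
apply: (@measurable_param_Rintegral _ (fun s u => green s u * F s)).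
apply: measurable_funM; first exact: measurable_green2.
exact: (measurableT_comp mF).
Qed.

Lemma green_integrable u : leb.-integrable setT (EFin \o (fun s => green s u * F s)).
Proof.
apply: (@leb_integrable_le _ _ (fun s => (W u)^-1 * (`|F s| * W s))).
- by apply: measurable_funM => //; exact: measurable_green1.
- exact: measurable_funM.
- move=> s; rewrite normrM (ger0_norm (green_ge0 _ _)).
  rewrite mulrCA [leLHS]mulrC ler_wpM2l// mulrC ler_pdivlMr//; exact: green_weight1.
- by rewrite ge0_lebZl// ?invr_ge0 ?ltW// lte_mul_pinfty// lee_fin invr_ge0 ltW.
Qed.

(** The factor c, taken inside the integral, is 1 for the pointwise bound and
    1 + A u for the absorption bound. *)
Lemma green_op_abs u (c : R) : 0 <= c ->
  ((c * (`|green_op F u| * W u))%:E <= \int[leb]_s (c * E s u * (`|F s| * W s))%:E)%E.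
Proof.
move=> c0.
have mgF : measurable_fun setT (fun s => `|green s u * F s|).
  by apply: measurableT_comp => //; apply: measurable_funM => //; exact: measurable_green1.
have cW0 : 0 <= c * W u by rewrite mulr_ge0// ltW.
apply: (@le_trans _ _ ((c * W u)%:E * \int[leb]_s (`|green s u * F s|)%:E)%E).
  have -> : c * (`|green_op F u| * W u) = (c * W u) * `|green_op F u| by ring.
  rewrite EFinM lee_wpmul2l ?lee_fin//.
  by apply: abs_Rintegral; exact: green_integrable.
rewrite -ge0_lebZl//; apply: ge0_le_leb.
- exact: measurable_funM.
- apply: measurable_funM => //; apply: measurable_funM => //; exact: measurable_E1.
- by move=> s; rewrite mulr_ge0.
- move=> s; rewrite -!mulrA ler_wpM2l// normrM (ger0_norm (green_ge0 _ _)).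
  have -> : W u * (green s u * `|F s|) = green s u * W u * `|F s| by ring.
  have -> : E s u * (`|F s| * W s) = E s u * W s * `|F s| by ring.
  by rewrite ler_wpM2r// green_weight.
Qed.

Lemma green_op_pointwise u : ((`|green_op F u| * W u)%:E <= wnorm F)%E.
Proof.
rewrite -[X in X%:E]mul1r; apply: le_trans (green_op_abs u ler01) _.
apply: ge0_le_leb => //.
- apply: measurable_funM => //; apply: measurable_funM => //; exact: measurable_E1.
- by move=> s; rewrite mul1r mulr_ge0// E_ge0.
- by move=> s; rewrite mul1r ler_piMl// E_le1.
Qed.

(** Exchanging the integrals leaves, for each s, the integral of (1 + A) e^{-B} from
    s on, which is at most 1.  The gain of the factor A over the plain norm is
    what makes the resolvent compact where A is large. *)
Lemma green_op_absorption : (\int[leb]_u ((1 + A u) * (`|green_op F u| * W u))%:E <= wnorm F)%E.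
Proof.
pose h (s u : R) : R := (1 + A u) * E s u * (`|F s| * W s).
have b0 u : 0 <= 1 + A u by rewrite addr_ge0.
have h0 s u : 0 <= h s u by rewrite mulr_ge0// mulr_ge0// E_ge0.
have mb : measurable_fun setT b by apply: measurable_funD.
have mh : measurable_fun setT (fun z : R * R => h z.1 z.2).
  apply: measurable_funM; last exact: (measurableT_comp mFW).
  apply: measurable_funM; last exact: measurable_E2.
  by apply: measurable_funD => //; exact: (measurableT_comp mA).
apply: (@le_trans _ _ (\int[leb]_u \int[leb]_s (h s u)%:E)%E).
  apply: ge0_le_lebe => //.
  - apply: measurable_funM => //.
    by apply: measurable_funM => //; apply: measurableT_comp => //; exact: measurable_green_op.
  - exact: measurable_param_integral.
  - by move=> u; rewrite !mulr_ge0// ltW.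
  - by move=> u; exact: green_op_abs.
rewrite tonelli_R//.
apply: ge0_lebe_le => //.
- exact: measurable_param_integral'.
- by move=> s; apply: integral_ge0 => u _; rewrite lee_fin.
- move=> s; rewrite /h.
  under eq_integral do rewrite mulrC.
  rewrite ge0_lebZl//; last 2 first.
  + apply: measurable_funM => //.
    apply: measurable_fun_ifT => //; first exact: measurable_fun_ler.
    apply: measurableT_comp => //; apply: measurableT_comp => //.
    by apply: measurable_funB => //; exact: measurable_B.
  + by move=> u; rewrite mulr_ge0// E_ge0.
  rewrite -[leRHS]mule1; apply: lee_wpmul2l; first by rewrite lee_fin.
  have := exp_decay mb b0 BE B_continuous s.
  rewrite integral_mkcond; apply: le_trans; rewrite le_eqVlt; apply/orP; left; apply/eqP.
  apply: eq_integral => u _; rewrite patchE /E mem_setE in_itv/= andbT.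
  by case: ifP => // _; rewrite mulr0.
Qed.

Lemma green_op_contraction : (wnorm (green_op F) <= wnorm F)%E.
Proof.
apply: le_trans green_op_absorption; apply: ge0_le_leb => //.
- by apply: measurable_funM => //; apply: measurableT_comp => //; exact: measurable_green_op.
- apply: measurable_funM; first exact: measurable_funD.
  by apply: measurable_funM => //; apply: measurableT_comp => //; exact: measurable_green_op.
- by move=> u; rewrite mulr_ge0// ltW.
- by move=> u; rewrite ler_peMl ?lerDl// mulr_ge0// ltW.
Qed.

(** The kernel is multiplicative, so the whole past of p acts at u only through
    the number green_op F p; this is where finite rank comes from. *)
Lemma green_op_split p u : p <= u ->
  green_op F u - expR (potential p - potential u) * green_op F p =
  \int[leb]_s (if p < s then green s u * F s else 0).
Proof.
move=> pu; rewrite /green_op -RintegralZl//; last exact: green_integrable.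
rewrite -RintegralB//; last 2 first.
- exact: green_integrable.
- exact: leb_integrableZl (green_integrable p).
apply: eq_Rintegral => s _; rewrite /green ltNge.
case: (leP s p) => sp /=; last by rewrite mul0r mulr0 subr0.
rewrite (le_trans sp pu).
have -> : expR (potential s - potential u) =
    expR (potential p - potential u) * expR (potential s - potential p).
  by rewrite -expRD; congr expR; ring.
by rewrite -mulrA subrr.
Qed.

Lemma measurable_green_cut (p u : R) :
  measurable_fun setT (fun s : R => if p < s then green s u * F s else 0).
Proof.
apply: measurable_fun_ifT => //; first exact: measurable_fun_ltr.
by apply: measurable_funM => //; exact: measurable_green1.
Qed.

Lemma green_cut_integrable p u :
  leb.-integrable setT (EFin \o (fun s : R => if p < s then green s u * F s else 0)).
Proof.
apply: (leb_integrable_abs _ _ (green_integrable u)); first exact: measurable_green_cut.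
by move=> s; case: ifP => _ //; rewrite normr0.
Qed.

(** The mass of F found in the h units of time before u, which bounds what
    green_op_split leaves out of a cell of length h. *)
Definition window (h u : R) : \bar R :=
  (\int[leb]_s (if (u - h < s) && (s <= u) then `|F s| * W s else 0)%:E)%E.

Lemma measurable_window2 (h : R) : measurable_fun setT
  (fun z : R * R => if (z.2 - h < z.1) && (z.1 <= z.2) then `|F z.1| * W z.1 else 0).
Proof.
apply: measurable_fun_ifT => //; last exact: (measurableT_comp mFW).
apply: measurable_and; last exact: measurable_fun_ler.
by apply: measurable_fun_ltr => //; exact: measurable_funB.
Qed.

Lemma measurable_window1 (h u : R) : measurable_fun setT
  (fun s : R => if (u - h < s) && (s <= u) then `|F s| * W s else 0).
Proof.
apply: measurable_fun_ifT => //.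
apply: measurable_and; last exact: measurable_fun_ler.
exact: measurable_fun_ltr.
Qed.

Lemma green_cut_window h p u : u - h <= p -> p <= u ->
  ((`|\int[leb]_s (if (p < s)%R then green s u * F s else 0)| * W u)%:E <= window h u)%E.
Proof.
move=> hp pu; rewrite mulrC.
apply: (@le_trans _ _ ((W u)%:E * \int[leb]_s (`|if (p < s)%R then green s u * F s else 0|)%:E)%E).
  rewrite EFinM lee_wpmul2l ?lee_fin ?(ltW (W0 _))//.
  by apply: abs_Rintegral; exact: green_cut_integrable.
have mc : measurable_fun setT (fun s => `|if p < s then green s u * F s else 0|).
  by apply: measurableT_comp => //; exact: measurable_green_cut.
rewrite -ge0_lebZl ?(ltW (W0 _))//.
apply: ge0_le_leb.
- exact: measurable_funM.
- exact: measurable_window1.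
- by move=> s; rewrite mulr_ge0// ltW.
- move=> s; case: (ltP p s) => ps; last first.
    by rewrite normr0 mulr0; case: ifP.
  rewrite (le_lt_trans hp ps) /=; case: ifP => su; last first.
    by rewrite /green su mul0r normr0 mulr0.
  rewrite normrM (ger0_norm (green_ge0 _ _)).
  have -> : W u * (green s u * `|F s|) = `|F s| * (green s u * W u) by ring.
  by rewrite ler_wpM2l// green_weight1.
Qed.

Lemma measurable_window h : measurable_fun setT (window h).
Proof.
apply: (@measurable_param_integral _ (fun s u => if (u - h < s) && (s <= u) then `|F s| * W s else 0)).
  exact: measurable_window2.
by move=> s u; case: ifP.
Qed.

Lemma integral_window h : 0 <= h -> (\int[leb]_u window h u = h%:E * wnorm F)%E.
Proof.
move=> h0; rewrite /window.
rewrite (@tonelli_R _ (fun s u => if (u - h < s) && (s <= u) then `|F s| * W s else 0)); last 2 first.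
- exact: measurable_window2.
- by move=> s u; case: ifP.
rewrite -ge0_lebZl//; apply: eq_integral => s _.
transitivity (\int[leb]_(u in `[s, (s + h)%R[) (`|F s| * W s)%:E)%E; last first.
  rewrite integral_cst//= lebesgue_measure_itv/= lte_fin.
  have [|hs] := ltP s (s + h); first by rewrite -EFinD addrAC subrr add0r -EFinM mulrC.
  have -> : h = 0 by move: hs; rewrite gerDl => hs; apply/eqP; rewrite eq_le hs h0.
  by rewrite mule0 mul0r.
rewrite [RHS]integral_mkcond; apply: eq_integral => u _.
by rewrite patchE mem_setE in_itv/= andbC ltrBlDr; case: ifP.
Qed.

Lemma measurable_damped_shift t : measurable_fun setT (damped_shift t F).
Proof.
have mt : measurable_fun setT (fun u : R => u - t) by exact: measurable_funB.
apply: measurable_funM; last exact: measurableT_comp mF mt.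
apply: measurableT_comp => //; apply: measurableT_comp => //.
apply: measurable_funB; first exact: measurable_damping.
exact: measurableT_comp measurable_damping mt.
Qed.

(** The exponent Q differs from the damping by a linear function, so the kernel
    transforms under a translation as the damped translations do. *)
Lemma green_op_shift t u : green_op (damped_shift t F) u = damped_shift t (green_op F) u.
Proof.
rewrite /green_op {2}/damped_shift -RintegralZl//; last exact: green_integrable.
pose f (x : R) : R := expR (- (P u - P (u - t))) * (green x (u - t) * F x).
have mf : measurable_fun setT f.
  by apply: measurable_funM => //; apply: measurable_funM => //; exact: measurable_green1.
rewrite -[RHS](Rintegral_translate (- t) mf).
have fE (s : R) : green s u * damped_shift t F s = f (s - t).
  rewrite /f /damped_shift /green lerD2r; case: (s <= u) => /=; last first.
    by rewrite (mul0r (expR _ * _)) (mul0r (F _)) mulr0.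
  by apply: expR_mulA; rewrite /potential; ring.
by apply: eq_Rintegral => s _; exact: fE.
Qed.

(** The part of the resolvent that the damped translation of length t does not
    reproduce comes from the last t units of time. *)
Lemma green_op_increment t u : 0 <= t ->
  green_op F u - expR (- ((om + 1) * t)) * damped_shift t (green_op F) u =
  \int[leb]_s (if u - t < s then green s u * F s else 0).
Proof.
move=> t0; rewrite -green_op_split; last by rewrite gerBl.
congr (_ - _); rewrite /damped_shift mulrA -expRD; congr (expR _ * _); rewrite /potential; ring.
Qed.

(** The substitution s = u - x turns the integral over the last t units of time
    into the integral of e^{- lam x} V(x) F over [0, t[, and t F into that of F;
    Minkowski's inequality for integrals, in the form of Tonelli's theorem, then
    bounds the difference. *)
Lemma green_op_increment_approx (t delta : R) : 0 <= t -> 0 <= delta ->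
  (forall tau, 0 <= tau -> tau <= t ->
    (\int[leb]_u (`|expR (- ((om + 1) * tau)) * damped_shift tau F u - F u| * W u)%:E <= delta%:E)%E) ->
  (\int[leb]_u (`|\int[leb]_s (if (u - t < s)%R then green s u * F s else 0) - t * F u| * W u)%:E
    <= (t * delta)%:E)%E.
Proof.
move=> t0 delta0 H.
pose on (x : R) := (0 <= x) && (x < t).
pose g (x u : R) : R := expR (- ((om + 1) * x)) * damped_shift x F u.
have mon : measurable_fun setT on.
  by apply: measurable_and; [exact: measurable_fun_ler|exact: measurable_fun_ltr].
have mg2 : measurable_fun setT (fun z : R * R => g z.1 z.2).
  have mux : measurable_fun setT (fun z : R * R => z.2 - z.1) by exact: measurable_funB.
  apply: measurable_funM.
    apply: measurableT_comp => //; apply: measurableT_comp => //.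
    exact: measurable_funM.
  apply: measurable_funM; last exact: measurableT_comp mF mux.
  apply: measurableT_comp => //; apply: measurableT_comp => //.
  apply: measurable_funB; first exact: (measurableT_comp measurable_damping).
  exact: measurableT_comp measurable_damping mux.
have mgu u : measurable_fun setT (g^~ u).
  exact: (measurableT_comp mg2 (pair2_measurable u)).
have gE u : forall x, (if u - t < u - x then green (u - x) u * F (u - x) else 0) =
    if on x then g x u else 0.
  move=> x; rewrite /on /green ltrD2l ltrN2 gerBl andbC.
  case: ifP => //= _; case: ifP => _; last by rewrite mul0r.
  by rewrite /g /damped_shift mulrA -expRD; congr (expR _ * _); rewrite /potential; ring.
have onF u : \int[leb]_x (if on x then F u else 0) = t * F u.
  transitivity (\int[leb]_(x in `[0%R, t[) F u).
    rewrite [RHS]Rintegral_mkcond; apply: eq_Rintegral => x _.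
    by rewrite patchE mem_setE in_itv.
  rewrite Rintegral_cst//= lebesgue_measure_itv/= lte_fin.
  have [t0'|] := ltP 0 t; first by rewrite -EFinD subr0 /= mulrC.
  by move=> t0'; have -> : t = 0 by [apply/eqP; rewrite eq_le t0 t0']; rewrite /= mulr0 mul0r.
have on1 : (\int[leb]_x (if on x then 1 else 0 : R)%:E = t%:E)%E.
  transitivity (\int[leb]_(x in `[0%R, t[) 1)%E.
    rewrite [RHS]integral_mkcond; apply: eq_integral => x _.
    by rewrite patchE mem_setE in_itv /on /=; case: ifP.
  rewrite integral_cst//= mul1e lebesgue_measure_itv/= lte_fin.
  have [t0'|t0'] := ltP 0 t; first by rewrite -EFinD subr0.
  by congr EFin; apply/eqP; rewrite eq_le t0 t0'.
have monu u : measurable_fun setT (fun x : R => if on x then F u else 0).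
  exact: measurable_fun_ifT.
have mong u : measurable_fun setT (fun x : R => if on x then g x u else 0).
  exact: measurable_fun_ifT.
have ionF u : leb.-integrable setT (EFin \o (fun x : R => if on x then F u else 0)).
  apply: (@leb_integrable_le _ _ (fun x : R => `|F u| * (if on x then 1 else 0))) => //.
  - by apply: measurable_funM => //; exact: measurable_fun_ifT.
  - by move=> x; case: ifP => _; rewrite ?mulr1 ?mulr0// normr0.
  - have m1 : measurable_fun setT (fun x : R => if on x then 1 else 0 : R).
      exact: measurable_fun_ifT.
    by rewrite ge0_lebZl ?on1 -?EFinM ?ltry// => x; case: ifP.
have iong u : leb.-integrable setT (EFin \o (fun x : R => if on x then g x u else 0)).
  apply/integrableP; split; first by apply/measurable_EFinP; exact: mong.
  have := green_cut_integrable (u - t) u => /integrableP[_].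
  have mc := measurable_green_cut (u - t) u.
  rewrite -(@integral_reflect _ u (fun s : R => (`|if u - t < s then green s u * F s else 0|)%:E)).
  - by under eq_integral do rewrite gE.
  - by apply/measurable_EFinP; apply: measurableT_comp.
  - by move=> x; rewrite lee_fin.
have diffE u : \int[leb]_s (if (u - t < s)%R then green s u * F s else 0) - t * F u =
    \int[leb]_x (if on x then g x u - F u else 0).
  rewrite -onF -(Rintegral_reflect u (measurable_green_cut (u - t) u)).
  under eq_Rintegral do rewrite gE.
  rewrite -RintegralB//; apply: eq_Rintegral => x _.
  by case: ifP => //; rewrite subr0.
pose h (x u : R) : R := if on x then `|g x u - F u| * W u else 0.
have h0 x u : 0 <= h x u by rewrite /h; case: ifP => // _; rewrite mulr_ge0// ltW.
have mh : measurable_fun setT (fun z : R * R => h z.1 z.2).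
  apply: measurable_fun_ifT => //; first exact: measurableT_comp mon measurable_fst.
  apply: measurable_funM; last exact: (measurableT_comp mW).
  apply: measurableT_comp => //; apply: measurable_funB => //.
  exact: (measurableT_comp mF).
apply: (@le_trans _ _ (\int[leb]_u \int[leb]_x (h x u)%:E)%E).
  apply: ge0_le_lebe => //.
  - apply: measurable_funM => //; apply: measurableT_comp => //.
    under eq_fun do rewrite diffE.
    apply: (@measurable_param_Rintegral _ (fun x u => if on x then g x u - F u else 0)).
    apply: measurable_fun_ifT => //; first exact: measurableT_comp mon measurable_fst.
    by apply: measurable_funB => //; exact: (measurableT_comp mF).
  - exact: measurable_param_integral.
  - by move=> u; rewrite mulr_ge0// ltW.
  - move=> u; rewrite diffE mulrC EFinM.
    apply: (@le_trans _ _ ((W u)%:E * \int[leb]_x (`|if on x then g x u - F u else 0|)%:E)%E).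
      rewrite lee_wpmul2l ?lee_fin ?(ltW (W0 _))//; apply: abs_Rintegral.
      have := integrableB measurableT (iong u) (ionF u).
      apply: eq_integrable => // x _ /=.
      by case: ifP => _; rewrite -?EFinB ?subr0.
    rewrite -ge0_lebZl ?(ltW (W0 _))//; last first.
      apply: measurableT_comp => //; apply: measurable_fun_ifT => //.
      exact: measurable_funB.
    rewrite le_eqVlt; apply/orP; left; apply/eqP; apply: eq_integral => x _.
    by rewrite /h; case: ifP => _; rewrite ?normr0 ?mulr0// mulrC.
rewrite tonelli_R//.
apply: (@le_trans _ _ (\int[leb]_x (delta * (if on x then 1 else 0))%:E)%E).
  apply: ge0_lebe_le.
  - by apply: measurable_funM => //; exact: measurable_fun_ifT.
  - exact: measurable_param_integral'.
  - by move=> x; apply: integral_ge0 => u _; rewrite lee_fin.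
  - move=> x; rewrite /h; case: ifP => [/andP[x0 xt]|_].
      by rewrite mulr1; apply: H => //; exact: ltW.
    by rewrite mulr0 integral0.
rewrite ge0_lebZl ?on1 -?EFinM 1?mulrC//; last by move=> x; case: ifP.
exact: measurable_fun_ifT.
Qed.

End fixed_source.

Hypothesis thin : forall c : R, 0 < c -> (leb [set u | (A u < c)%R] < +oo)%E.

(** Where A >= c the absorption bound gives a mass of at most M / c.  The part of
    {A < c} outside ]-N, N] has small measure for large N, by continuity from
    above, and the pointwise bound gives a mass of at most M times that measure.
    N depends on F only through M. *)
Lemma green_op_tail (M e : R) : 0 <= M -> 0 < e -> exists N : nat,
  forall F, measurable_fun setT F -> (wnorm F <= M%:E)%E ->
  (\int[leb]_u (if ((- N%:R < u) && (u <= N%:R))%R then 0 else `|green_op F u| * W u)%:E <= e%:E)%E.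
Proof.
move=> M0 e0.
(* Chosen so that M / c <= e / 2, and c > 0 also when M = 0. *)
pose c := 2 * M / e + 1.
have Me0 : 0 <= 2 * M / e by rewrite divr_ge0 ?mulr_ge0// ltW.
have c0 : 0 < c by rewrite ltr_wpDl.
pose S := [set u | A u < c].
have mS : measurable S.
  have -> : S = A @^-1` `]-oo, c[%classic.
    by apply/seteqP; split => u; rewrite /S /= in_itv.
  by rewrite -[X in measurable X]setTI; exact: mA.
pose T (N : nat) : set R := S `\` `]- N%:R, N%:R]%classic.
have mT N : measurable (T N) by apply: measurableD => //; exact: measurable_itv.
have TS N : (leb (T N) <= leb S)%E.
  by apply: le_measure => //; [exact: mem_set (mT N)|exact: mem_set mS|exact: subDsetl].
have T0 : \bigcap_N T N = set0.
  rewrite -subset0 => u Tu.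
  pose n := (Num.truncn `|u|).+1.
  have un : `|u| < n%:R by exact: truncnS_gt.
  have [_ /=] := Tu n I; rewrite in_itv/=; apply.
  by move: un; rewrite ltr_norml => /andP[-> /ltW ->].
have [N TN] : exists N, (leb (T N) <= (e / (2 * (M + 1)))%:E)%E.
  have cv : leb (T n) @[n --> \oo] --> 0%E.
    rewrite -(@measure0 _ _ _ leb) -T0; apply: nonincreasing_cvg_mu => //.
    - exact: le_lt_trans (TS 0%N) (thin c0).
    - by rewrite T0.
    - move=> n m nm; apply/subsetPset => u [Su /= nu]; split => //= um; apply: nu.
      move: um; rewrite !in_itv/= => /andP[mu um].
      have nmR : n%:R <= m%:R :> R by rewrite ler_nat.
      by rewrite (le_trans um nmR) (le_lt_trans _ mu)// lerN2.
  have Me : 0 < e / (2 * (M + 1)) by rewrite divr_gt0// mulr_gt0// ltr_wpDl.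
  have /cvgrPdist_le /(_ _ Me) [n _ /(_ n (leqnn _))] : fine (leb (T n)) @[n --> \oo] --> (0 : R).
    exact: fine_cvg cv.
  rewrite /= sub0r normrN => H; exists n.
  rewrite -[X in (X <= _)%E]fineK; first by rewrite lee_fin (le_trans _ H)// ler_norm.
  rewrite ge0_fin_numE//; exact: le_lt_trans (TS n) (thin c0).
exists N => F mF FM.
have FW : (wnorm F < +oo)%E by rewrite (le_lt_trans FM)// ltry.
have mgW : measurable_fun setT (fun u => `|green_op F u| * W u).
  by apply: measurable_funM => //; apply: measurableT_comp => //; exact: measurable_green_op.
have gW0 u : 0 <= `|green_op F u| * W u by rewrite mulr_ge0// ltW.
have mbg : measurable_fun setT (fun u => (1 + A u) * (`|green_op F u| * W u)).
  by apply: measurable_funM => //; exact: measurable_funD.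
have bg0 u : 0 <= (1 + A u) * (`|green_op F u| * W u) by rewrite mulr_ge0// addr_ge0.
have mI : measurable_fun setT (fun u => \1_(T N) u : R) by exact: measurable_indic.
apply: (@le_trans _ _ (\int[leb]_u (c^-1 * ((1 + A u) * (`|green_op F u| * W u)) + M * \1_(T N) u)%:E)%E).
  apply: ge0_le_leb.
  - apply: measurable_fun_ifT => //.
    by apply: measurable_and; [exact: measurable_fun_ltr|exact: measurable_fun_ler].
  - by apply: measurable_funD; apply: measurable_funM.
  - by move=> u; case: ifP.
  - move=> u.
    have i0 : 0 <= M * \1_(T N) u by rewrite mulr_ge0// indicE.
    have j0 : 0 <= c^-1 * ((1 + A u) * (`|green_op F u| * W u)) by rewrite mulr_ge0// invr_ge0 ltW.
    case: ifPn => [_|uN]; first exact: addr_ge0.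
    have [Auc|cA] := ltP (A u) c.
      rewrite ler_wpDl// indicE mem_set ?mulr1; last first.
        by split => //=; rewrite in_itv/=; exact/negP.
      by rewrite -lee_fin (le_trans (green_op_pointwise mF FW u)).
    rewrite ler_wpDr// mulrA ler_peMl// mulrC ler_pdivlMr// mul1r.
    by rewrite (le_trans cA)// lerDr.
rewrite ge0_lebD//; last 4 first.
- exact: measurable_funM.
- exact: measurable_funM.
- by move=> u; rewrite mulr_ge0// invr_ge0 ltW.
- by move=> u; rewrite mulr_ge0// indicE.
rewrite ge0_lebZl// ?invr_ge0 ?(ltW c0)//.
rewrite ge0_lebZl// integral_indic//; last exact: (mT N).
rewrite setIT.
apply: (@le_trans _ _ ((c^-1)%:E * M%:E + M%:E * (e / (2 * (M + 1)))%:E)%E).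
  apply: leeD.
    apply: lee_wpmul2l; first by rewrite lee_fin invr_ge0 ltW.
    by apply: le_trans FM; exact: green_op_absorption.
  by apply: lee_wpmul2l.
rewrite -!EFinM -EFinD lee_fin.
have h1 : c^-1 * M <= e / 2.
  rewrite mulrC ler_pdivrMr// /c mulrDr mulr1.
  have -> : e / 2 * (2 * M / e) = M by field; rewrite gt_eqF.
  by rewrite lerDl divr_ge0// ltW.
have h2 : M * (e / (2 * (M + 1))) <= e / 2.
  have M10 : 0 < M + 1 by rewrite ltr_wpDl.
  rewrite mulrA ler_pdivrMr ?mulr_gt0//.
  have -> : e / 2 * (2 * (M + 1)) = M * e + e by field.
  by rewrite lerDl ltW.
by rewrite [leRHS](splitr e) lerD.
Qed.

(** The profile, on ]p, p + h], of the solution that has the value 1 at p and no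
    source after p. *)
Definition cell (p h u : R) : R :=
  if (p < u) && (u <= p + h) then expR (potential p - potential u) else 0.

Lemma measurable_cell p h : measurable_fun setT (cell p h).
Proof.
apply: measurable_fun_ifT => //.
  by apply: measurable_and; [exact: measurable_fun_ltr|exact: measurable_fun_ler].
by apply: measurableT_comp => //; apply: measurable_funB => //; exact: measurable_potential.
Qed.

Lemma cell_wnorm p h : 0 <= h -> (wnorm (cell p h) < +oo)%E.
Proof.
move=> h0.
apply: (@le_lt_trans _ _ (\int[leb]_u (W p * \1_(`]p, (p + h)%R]%classic) u)%:E)%E).
  apply: ge0_le_leb.
  - by apply: measurable_funM => //; apply: measurableT_comp => //; exact: measurable_cell.
  - by apply: measurable_funM => //; exact: measurable_indic.
  - by move=> u; rewrite mulr_ge0// ltW.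
  - move=> u; rewrite indicE mem_setE in_itv/= /cell; case: ifP => pu; last first.
      by rewrite normr0 mul0r mulr0.
    rewrite mulr1 ger0_norm ?expR_ge0//; apply: le_trans (green_weight1 p u).
    by case/andP : pu => /ltW pu _; rewrite /green pu.
rewrite ge0_lebZl ?(ltW (W0 _))//.
rewrite integral_indic//= setIT lebesgue_measure_itv/= lte_fin.
by case: ifP => _; rewrite ?mule0// -EFinD -EFinM ltry.
Qed.

(** The cells are disjoint, so that at most one of them contributes at u; the two
    claims are proved together, by induction on the number of cells. *)
Lemma green_op_cells (F : R -> R) (q h : R) (n : nat) u :
  measurable_fun setT F -> (wnorm F < +oo)%E -> 0 <= h ->
  let S := \sum_(j < n) green_op F (q + j%:R * h) * cell (q + j%:R * h) h u in
  ((u <= q) || (q + n%:R * h < u) -> S = 0) /\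
  ((q < u) && (u <= q + n%:R * h) -> ((`|green_op F u - S| * W u)%:E <= window F h u)%E).
Proof.
move=> mF FW h0; elim: n => [|n [IH1 IH2]] /=.
  rewrite mul0r addr0; split=> [_|/andP[/lt_le_trans H /H]]; first by rewrite big_ord0.
  by rewrite ltxx.
have nh : n.+1%:R * h = n%:R * h + h by rewrite -natr1 mulrDl mul1r.
have nh0 : 0 <= n%:R * h by rewrite mulr_ge0.
have c0 : u <= q + n%:R * h -> cell (q + n%:R * h) h u = 0.
  by rewrite /cell leNgt => /negbTE ->.
have c0' : q + n.+1%:R * h < u -> cell (q + n%:R * h) h u = 0.
  by rewrite nh addrA /cell ltNge => /negbTE ->; rewrite andbF.
have c1 : q + n%:R * h < u -> u <= q + n.+1%:R * h ->
    ((`|green_op F u - green_op F (q + n%:R * h) * cell (q + n%:R * h) h u| * W u)%:E <= window F h u)%E.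
  rewrite nh addrA /cell => nu un; rewrite nu un (mulrC (green_op F _) (expR _)) green_op_split ?(ltW nu)//.
  apply: green_cut_window => //; last exact: ltW.
  by rewrite lerBlDr.
rewrite big_ord_recr /=.
move: (cell _ _ _) (green_op F (q + _)) c0 c0' c1 => c a c0 c0' c1.
move: (\sum_(i < n) _) IH1 IH2 => S IH1 IH2; split.
  case/orP => uq.
    by rewrite IH1 ?uq// add0r c0 ?mulr0// (le_trans uq)// lerDl.
  rewrite IH1; last by rewrite (le_lt_trans _ uq) ?orbT// lerD2l nh lerDl.
  by rewrite add0r c0' ?mulr0.
move=> /andP[qu un].
have [nu|un'] := ltP (q + n%:R * h) u; last first.
  by rewrite c0// mulr0 addr0; apply: IH2; rewrite qu un'.
by rewrite IH1 ?nu ?orbT// add0r; exact: c1.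
Qed.

(** ]-N, N] is cut into m cells of length h = 2 N / m.  The windows, of total mass
    h M, account for one half of e and the tail outside ]-N, N] for the other. *)
Lemma green_op_finite_rank (M e : R) : 0 <= M -> 0 < e ->
  exists n (q h : R), 0 <= h /\
    forall F, measurable_fun setT F -> (wnorm F <= M%:E)%E ->
    (wnorm (fun u => green_op F u -
       \sum_(j < n) green_op F (q + j%:R * h) * cell (q + j%:R * h) h u)%R <= e%:E)%E.
Proof.
move=> M0 e0.
have e2 : 0 < e / 2 by rewrite divr_gt0.
have [N HN] := green_op_tail M0 e2.
pose m := (Num.truncn (2 * N%:R * M / (e / 2))).+1.
pose h : R := 2 * N%:R / m%:R.
have m0 : 0 < m%:R :> R by rewrite ltr0n.
have h0 : 0 <= h by rewrite divr_ge0 ?mulr_ge0// ltW.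
have hM : h * M <= e / 2.
  rewrite /h mulrAC ler_pdivrMr// [leRHS]mulrC -ler_pdivrMr//.
  by apply: ltW; exact: truncnS_gt.
have mh : m%:R * h = 2 * N%:R by rewrite /h mulrC divfK// gt_eqF.
exists m, (- N%:R), h; split => // F mF FM.
have FW : (wnorm F < +oo)%E by rewrite (le_lt_trans FM)// ltry.
have mgW : measurable_fun setT (fun u => `|green_op F u| * W u).
  by apply: measurable_funM => //; apply: measurableT_comp => //; exact: measurable_green_op.
set S := fun u => \sum_(j < m) green_op F (- N%:R + j%:R * h) * cell (- N%:R + j%:R * h) h u.
have mSu : measurable_fun setT S.
  by apply: measurable_sum => j; apply: measurable_funM => //; exact: measurable_cell.
pose t u := if (- N%:R < u) && (u <= N%:R) then 0 else `|green_op F u| * W u.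
have mt : measurable_fun setT t.
  apply: measurable_fun_ifT => //.
  by apply: measurable_and; [exact: measurable_fun_ltr|exact: measurable_fun_ler].
have t0 u : 0 <= t u by rewrite /t; case: ifP => // _; rewrite mulr_ge0// ltW.
have w0 u : (0 <= window F h u)%E.
  by apply: integral_ge0 => s _; rewrite lee_fin; case: ifP => // _; rewrite mulr_ge0// ltW.
have mw : measurable_fun setT (window F h) by exact: measurable_window.
apply: (@le_trans _ _ (\int[leb]_u (window F h u + (t u)%:E))%E).
  apply: ge0_le_lebe.
  - by apply: measurable_funM => //; apply: measurableT_comp => //;
       apply: measurable_funB => //; exact: measurable_green_op.
  - by apply: emeasurable_funD => //; exact/measurable_EFinP.
  - by move=> u; rewrite mulr_ge0// ltW.
  - move=> u; have [] := @green_op_cells F (- N%:R) h m u mF FW h0.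
    have -> : - N%:R + m%:R * h = N%:R by rewrite mh mulrDl mul1r addKr.
    rewrite -/(S u) /t => H1 H2; case: ifPn => uN; first by rewrite adde0 H2.
    rewrite H1 ?subr0 ?leeDr//.
    by move: uN; rewrite negb_and -leNgt -ltNge.
rewrite ge0_integralD//; last 2 first.
- by move=> u _; rewrite lee_fin.
- exact/measurable_EFinP.
rewrite integral_window// [e in leRHS]splitr EFinD; apply: leeD; last exact: HN.
apply: (@le_trans _ _ (h%:E * M%:E)%E); first by rewrite lee_wpmul2l.
by rewrite -EFinM lee_fin.
Qed.

End damped.

(** * Growth of the weight along the flow *)

Section weight_growth.
Context {R : realType}.
Local Notation leb := (@lebesgue_measure R).

Lemma integral_inv_affine (c x y : R) : 0 <= c -> 0 < x -> x <= y ->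
  (\int[leb]_(z in `[x, y]) ((c + z)^-1)%:E = (ln (c + y) - ln (c + x))%:E)%E.
Proof.
move=> c0 x0; rewrite le_eqVlt => /orP[/eqP <-|xy].
  by rewrite subrr set_itv1 integral_set1.
have pos z : x <= z -> 0 < c + z by move=> xz; rewrite ltr_wpDl// (lt_le_trans x0).
have dln z : x <= z -> is_derive z 1 (fun z => ln (c + z)) (c + z)^-1.
  move=> xz; have := pos z xz => cz.
  have h := is_derive1_ln cz.
  have h2 : is_derive z 1 (fun z : R => c + z) 1.
    by have := is_deriveD (is_derive_cst c z 1) (is_derive_id z 1); rewrite add0r.
  have := @is_derive1_comp _ (@ln R) (fun z : R => c + z) z _ _ h h2.
  by rewrite mulr1.
rewrite (@continuous_FTC2 _ _ (fun z => ln (c + z)))//.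
- apply: continuous_in_subspaceT => z; rewrite inE/= in_itv/= => /andP[xz _].
  apply: (@continuousV _ _ (fun z => c + z)); first by rewrite gt_eqF// pos.
  by apply: cvgD; [exact: cvg_cst|exact: cvg_id].
- have cn z : x <= z -> {for z, continuous (fun z => ln (c + z))}.
    by move=> /dln /@ex_derive /derivable1_diffP /differentiable_continuous.
  split.
  + by move=> z; rewrite in_itv/= => /andP[/ltW xz _]; have /@ex_derive := dln z xz.
  + by apply: cvg_at_right_filter; exact: cn.
  + by apply: cvg_at_left_filter; apply: cn; exact: ltW.
- move=> z; rewrite in_itv/= => /andP[/ltW xz _].
  by rewrite derive1E; have /@derive_val := dln z xz.
Qed.

Lemma RposE (x : R) : Rpos x <-> 0 < x.
Proof. by rewrite /Rpos /= in_itv/= andbT. Qed.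

Lemma measurable_inv_comp (D : set R) (f : R -> R) : measurable D ->
  measurable_fun D f -> (forall x, D x -> 0 < f x) ->
  measurable_fun D (fun x => (f x)^-1).
Proof.
move=> mD mf f0; apply: (@measurable_comp _ _ _ _ _ _ (@Rpos R) (@GRing.inv R)) => //.
- exact: measurable_Rpos.
- by move=> _ [x Dx <-]; apply/RposE; exact: f0.
- apply: open_continuous_measurable_fun; first exact: interval_open.
  move=> x /set_mem /RposE x0; apply: (@continuousV _ _ (fun z => z)); last exact: cvg_id.
  by rewrite gt_eqF.
Qed.

Lemma sub_itv_Rpos (x y : R) : 0 < x -> `[x, y] `<=` @Rpos R.
Proof.
by move=> x0 z; rewrite /= in_itv/= => /andP[xz _]; apply/RposE; exact: lt_le_trans xz.
Qed.

(** Since 1/r >= 1 / (C (c + z)), the time t needed to go from x to y is at least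
    (ln (c + y) - ln (c + x)) / C. *)
Lemma weight_growth (alpha c C t x y : R) : 0 < alpha -> 0 <= c -> 0 < C -> 0 < x -> x <= y ->
  forall r : R -> R, measurable_fun (@Rpos R) r -> (forall z, 0 < z -> 0 < r z) ->
  (forall z, 0 < z -> r z <= C * (c + z)) ->
  (\int[leb]_(z in `[x, y]) ((r z)^-1)%:E = t%:E)%E ->
  (c + y) `^ alpha <= expR (alpha * C * t) * (c + x) `^ alpha.
Proof.
move=> a0 c0 C0 x0 xy r mr r0 rC rt.
have cx : 0 < c + x by rewrite ltr_wpDl.
have cy : 0 < c + y by rewrite ltr_wpDl// (lt_le_trans x0).
have sub := @sub_itv_Rpos x y x0.
have mcz : measurable_fun `[x, y] (fun z : R => (c + z)^-1).
  apply: measurable_inv_comp => //; first exact: measurable_funD.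
  by move=> z /sub /RposE z0; rewrite ltr_wpDl.
have mrz : measurable_fun `[x, y] (fun z : R => (r z)^-1).
  apply: measurable_inv_comp => //; first by apply: measurable_funS mr => //; exact: measurable_Rpos.
  by move=> z /sub /RposE; exact: r0.
have lnt : C^-1 * (ln (c + y) - ln (c + x)) <= t.
  rewrite -lee_fin -rt EFinM -integral_inv_affine//.
  rewrite -ge0_integralZl ?lee_fin ?invr_ge0 ?(ltW C0)//; last 2 first.
  - exact/measurable_EFinP.
  - move=> z /sub /RposE z0; rewrite lee_fin invr_ge0.
    by rewrite addr_ge0// ltW.
  apply: ge0_le_integral => //.
  - move=> z /sub /RposE z0; rewrite -EFinM lee_fin.
    by rewrite mulr_ge0// invr_ge0 ?addr_ge0// ltW.
  - by apply: measurable_funeM; exact/measurable_EFinP.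
  - exact/measurable_EFinP.
  - move=> z /sub /RposE z0; rewrite -EFinM lee_fin.
    rewrite -invfM lef_pV2 ?posrE ?r0 ?mulr_gt0 ?ltr_wpDl//; exact: rC.
rewrite /powR !gt_eqF// -expRD ler_expR.
have -> : alpha * ln (c + y) = alpha * (ln (c + y) - ln (c + x)) + alpha * ln (c + x) by ring.
rewrite lerD2r -mulrA ler_wpM2l ?(ltW a0)//.
by rewrite -ler_pdivrMl// mulrC.
Qed.

End weight_growth.

(** * The flow as a time coordinate *)

Section flow.
Context {R : realType}.
Local Notation leb := (@lebesgue_measure R).
Variables (r : R -> R).
Hypotheses (r_cont : {within Rpos, continuous r}) (r_gt0 : forall x, 0 < x -> 0 < r x).
Hypothesis r_div0 : (\int[leb]_(tau in `]0%R, 1%R]) ((r tau)^-1)%:E = +oo)%E.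
Hypothesis r_divy : (\int[leb]_(tau in [set x : R | (1 <= x)%R]) ((r tau)^-1)%:E = +oo)%E.

Lemma measurable_r : measurable_fun Rpos r.
Proof. by apply: subspace_continuous_measurable_fun => //; exact: measurable_Rpos. Qed.

Lemma measurable_rV : measurable_fun Rpos (fun x => (r x)^-1).
Proof.
apply: measurable_inv_comp; [exact: measurable_Rpos|exact: measurable_r|].
by move=> x /RposE; exact: r_gt0.
Qed.

Lemma rV_gt0 x : Rpos x -> 0 < (r x)^-1.
Proof. by move=> /RposE x0; rewrite invr_gt0 r_gt0. Qed.

Lemma Rpos_itv : is_interval (@Rpos R).
Proof.
move=> x y /RposE x0 /RposE y0 z /andP[xz zy]; apply/RposE; exact: lt_le_trans xz.
Qed.

Lemma r_cont_itv s u : 0 < s -> {within `[s, u], continuous r}.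
Proof. by move=> s0; apply: continuous_subspaceW r_cont; exact: sub_itv_Rpos. Qed.

Lemma rV_cont_itv s u : 0 < s -> {within `[s, u], continuous (fun x => (r x)^-1)}.
Proof.
move=> s0; have := @r_cont_itv s u s0 => rc.
apply/subspace_continuousP => x xs /=.
have x0 : 0 < x by apply/RposE; exact: sub_itv_Rpos xs.
have /subspace_continuousP /(_ x xs) := rc.
by apply: cvgV; rewrite gt_eqF// r_gt0.
Qed.

Lemma rV_integrable s u : Rpos s -> Rpos u ->
  leb.-integrable `[s, u] (EFin \o (fun x => (r x)^-1)).
Proof.
move=> /RposE s0 _; apply: continuous_compact_integrable; first exact: segment_compact.
exact: rV_cont_itv.
Qed.

(** The time that the flow of r takes from 1 to x, negative for x < 1. *)
Definition ftime : R -> R := primitive (fun x => (r x)^-1) 1.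

Lemma Rpos1 : Rpos (1 : R). Proof. exact/RposE. Qed.

Lemma ftimeE s u : 0 < s -> s <= u ->
  ((ftime u - ftime s)%:E = \int[leb]_(x in `[s, u]) ((r x)^-1)%:E)%E.
Proof.
move=> s0 su; apply: (@primitiveE _ Rpos) => //; [exact: Rpos1|exact: rV_integrable|exact/RposE|].
by apply/RposE; exact: lt_le_trans su.
Qed.

Lemma ftime_lt s u : 0 < s -> s < u -> ftime s < ftime u.
Proof.
move=> s0 su; rewrite -subr_gt0 -lte_fin ftimeE ?ltW//.
have [c cs rc] := EVT_max (ltW su) (@r_cont_itv s u s0).
have rc0 : 0 < r c by apply: r_gt0; move: cs; rewrite in_itv/= => /andP[sc _]; exact: lt_le_trans sc.
apply: (@lt_le_trans _ _ (\int[leb]_(x in `[s, u]) ((r c)^-1)%:E)%E).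
  rewrite integral_cst//= lebesgue_measure_itv/= lte_fin su -EFinD -EFinM lte_fin.
  by rewrite mulr_gt0 ?invr_gt0// subr_gt0.
have sub := @sub_itv_Rpos _ s u s0.
apply: ge0_le_integral => //.
- by move=> x _; rewrite lee_fin invr_ge0 ltW.
- apply/measurable_EFinP; apply: measurable_funS measurable_rV => //; exact: measurable_Rpos.
- move=> x xs; have /RposE x0 := sub _ xs.
  by rewrite lee_fin lef_pV2 ?posrE; [exact: rc|exact: rc0|exact: r_gt0].
Qed.

Lemma ftime_le s u : 0 < s -> s <= u -> ftime s <= ftime u.
Proof. by move=> s0; rewrite le_eqVlt => /orP[/eqP->//|su]; rewrite ltW// ftime_lt. Qed.

Lemma ftime_inj s u : 0 < s -> 0 < u -> ftime s = ftime u -> s = u.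
Proof.
move=> s0 u0 Hsu; have [su|us|//] := ltgtP s u.
- by have := ftime_lt s0 su; rewrite Hsu ltxx.
- by have := ftime_lt u0 us; rewrite Hsu ltxx.
Qed.

Lemma ftime_continuous s u : 0 < s -> s <= u -> {within `[s, u], continuous ftime}.
Proof.
move=> s0 su; apply: (@primitive_continuous _ Rpos) => //;
  [exact: Rpos_itv|exact: Rpos1|exact: rV_integrable|exact/RposE|].
by apply/RposE; exact: lt_le_trans su.
Qed.

(** If ftime were bounded by v then so would be the integral of 1/r over
    [1, +oo[, the union of the [1, 1 + n]. *)
Lemma ftime_unbounded_above v : exists2 q, 1 <= q & v <= ftime q.
Proof.
apply: contrapT => /forall2NP nq.
have Hv q : 1 <= q -> ftime q <= v.
  by move=> q1; have [//|/negP] := nq q; rewrite -ltNge => /ltW.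
have : (\int[leb]_(x in \bigcup_n `[1%R, (1 + n%:R)%R]%classic) ((r x)^-1)%:E <= (v - ftime 1)%:E)%E.
  have sub n := @sub_itv_Rpos R 1 (1 + n%:R) ltr01.
  apply: integral_bigcup_le.
  - move=> n m nm x /=; rewrite !in_itv/= => /andP[-> /le_trans]; apply.
    by rewrite lerD2l ler_nat.
  - by move=> n; exact: measurable_itv.
  - by move=> n; apply: measurable_funS measurable_rV => //; exact: measurable_Rpos.
  - by move=> n x /sub /rV_gt0 /ltW.
  - by move=> n; rewrite -ftimeE ?lerDl// lee_fin lerD2r Hv// lerDl.
rewrite -itv_bndy_bigcup_BRight.
have -> : `[1, +oo[%classic = [set x : R | 1 <= x].
  by apply/seteqP; split => x; rewrite /= in_itv/= andbT.
by rewrite r_divy leye_eq.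
Qed.

Lemma ftime_unbounded_below v : exists2 p, 0 < p <= 1 & ftime p <= v.
Proof.
apply: contrapT => /forall2NP nq.
have Hv q : 0 < q <= 1 -> v <= ftime q.
  by move=> q1; have [//|/negP] := nq q; rewrite -ltNge => /ltW.
have n0 n : 0 < n.+1%:R^-1 :> R by rewrite invr_gt0.
have n1 n : n.+1%:R^-1 <= 1 :> R by rewrite invf_le1// ler1n.
have : (\int[leb]_(x in \bigcup_n `[n.+1%:R^-1%R, 1%R]%classic) ((r x)^-1)%:E <= (ftime 1 - v)%:E)%E.
  have sub n := @sub_itv_Rpos R n.+1%:R^-1 1 (n0 n).
  apply: integral_bigcup_le.
  - move=> n m nm x /=; rewrite !in_itv/= => /andP[+ ->]; rewrite andbT; apply: le_trans.
    by rewrite lef_pV2 ?posrE// ler_nat.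
  - by move=> n; exact: measurable_itv.
  - by move=> n; apply: measurable_funS measurable_rV => //; exact: measurable_Rpos.
  - by move=> n x /sub /rV_gt0 /ltW.
  - by move=> n; rewrite -ftimeE// lee_fin lerD2l lerN2 Hv// n0 n1.
have -> : \bigcup_n `[n.+1%:R^-1, 1]%classic = `]0, 1]%classic :> set R.
  apply/seteqP; split => x.
    by move=> [n _] /=; rewrite !in_itv/= => /andP[/(lt_le_trans (n0 n)) -> ->].
  rewrite /= in_itv/= => /andP[x0 x1]; exists (Num.truncn x^-1) => //=.
  rewrite in_itv/= x1 andbT -[leRHS]invrK lef_pV2 ?posrE ?invr_gt0//.
  by apply: ltW; exact: truncnS_gt.
by rewrite r_div0 leye_eq.
Qed.

Lemma ftime_surj v : exists x, 0 < x /\ ftime x = v.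
Proof.
have [q q1 vq] := ftime_unbounded_above v.
have [p /andP[p0 p1] pv] := ftime_unbounded_below v.
have pq := le_trans p1 q1.
have [|x] := @IVT _ ftime p q v pq (ftime_continuous p0 pq).
  by rewrite ge_min pv le_max vq orbT.
by rewrite in_itv/= => /andP[px _] <-; exists x; split => //; exact: lt_le_trans px.
Qed.

(** The position reached from 1 at time v, that is the inverse of ftime. *)
Definition fpos v := xget 1 [set x | 0 < x /\ ftime x = v].

Lemma fposP v : 0 < fpos v /\ ftime (fpos v) = v.
Proof.
rewrite /fpos; case: xgetP => [x _ []//|nx].
by have [x xP] := ftime_surj v; have := nx x xP.
Qed.

Lemma fpos_gt0 v : 0 < fpos v. Proof. by have [] := fposP v. Qed.
Lemma fposK v : ftime (fpos v) = v. Proof. by have [] := fposP v. Qed.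
Lemma ftimeK x : 0 < x -> fpos (ftime x) = x.
Proof. by move=> x0; apply: ftime_inj => //; rewrite ?fpos_gt0 ?fposK. Qed.

Lemma fpos_le v w : v <= w -> fpos v <= fpos w.
Proof.
move=> vw; rewrite leNgt; apply/negP => wv.
by have := ftime_lt (fpos_gt0 w) wv; rewrite !fposK ltNge vw.
Qed.

Lemma ftime_leE x v : 0 < x -> (ftime x <= v) = (x <= fpos v).
Proof.
move=> x0; apply/idP/idP => h; first by rewrite -(ftimeK x0) fpos_le.
by rewrite -[v]fposK ftime_le.
Qed.

Lemma ftime_ltE x v : 0 < x -> (v < ftime x) = (fpos v < x).
Proof. by move=> x0; rewrite !ltNge ftime_leE. Qed.

Lemma fpos_leE x v : 0 < x -> (fpos v <= x) = (v <= ftime x).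
Proof.
move=> x0; apply/idP/idP => h; last by rewrite -(ftimeK x0) fpos_le.
by rewrite -[v]fposK ftime_le// fpos_gt0.
Qed.

Lemma measurable_fpos : measurable_fun setT fpos.
Proof. by apply: nondecreasing_measurable => // x y; exact: fpos_le. Qed.

(** ftime is meaningful on ]0, +oo[ only; this extension by 0 is measurable on the
    whole line, as a push-forward requires. *)
Definition ftime0 (x : R) : R := if 0 < x then ftime x else 0.

Lemma measurable_ftime : measurable_fun Rpos ftime.
Proof.
apply: open_continuous_measurable_fun; first exact: interval_open.
move=> x /set_mem /RposE x0.
have xx : x / 2 < x + 1 by lra.
have x20 : 0 < x / 2 by lra.
have /(continuous_within_itvP _ xx)[h _ _] := ftime_continuous x20 (ltW xx).
by apply: h; rewrite in_itv/=; lra.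
Qed.

Lemma measurable_ftime0 : measurable_fun setT ftime0.
Proof.
apply: measurable_fun_if => //; first exact: measurable_fun_ltr.
rewrite setTI; apply: measurable_funS measurable_ftime; first exact: measurable_Rpos.
by move=> x /= x0; apply/RposE.
Qed.

Definition rV0 (x : R) : R := if 0 < x then (r x)^-1 else 0.

Lemma rV0_ge0 x : 0 <= rV0 x.
Proof. by rewrite /rV0; case: ifP => // x0; rewrite invr_ge0 ltW// r_gt0. Qed.

Lemma measurable_rV0 : measurable_fun setT rV0.
Proof.
apply: measurable_fun_if => //; first exact: measurable_fun_ltr.
rewrite setTI; apply: measurable_funS measurable_rV; first exact: measurable_Rpos.
by move=> x /= x0; apply/RposE.
Qed.

Definition flow_measure (X : set R) : \bar R := (\int[leb]_(x in X `&` Rpos) (rV0 x)%:E)%E.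

Let flow_measure0 : flow_measure set0 = 0%E.
Proof. by rewrite /flow_measure set0I integral_set0. Qed.

Let flow_measure_ge0 X : (0 <= flow_measure X)%E.
Proof. by apply: integral_ge0 => x _; rewrite lee_fin rV0_ge0. Qed.

Let flow_measure_sigma_additive : semi_sigma_additive flow_measure.
Proof. exact: (density_sigma_additive measurable_rV0 rV0_ge0). Qed.

HB.instance Definition _ := isMeasure.Build _ _ _ flow_measure
  flow_measure0 flow_measure_ge0 flow_measure_sigma_additive.

(** The push-forward of dx / r by ftime gives the interval ]p, q] the mass q - p, so
    it is the Lebesgue measure. *)
Lemma change_of_variables (f : R -> R) : measurable_fun setT f -> (forall u, 0 <= f u) ->
  (\int[leb]_u (f u)%:E = \int[leb]_(x in Rpos) (f (ftime x) * (r x)^-1)%:E)%E.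
Proof.
move=> mf f0.
have mH : measurable_fun setT (ftime0 : R -> measurableTypeR R) by exact: measurable_ftime0.
transitivity (\int[pushforward flow_measure (ftime0 : R -> measurableTypeR R)]_u (f u)%:E)%E.
  apply: eq_measure_integral => //= A mA _; apply/lebesgue_measure_unique => //=.
  move=> _ [[p q]] _ <-; rewrite /pushforward /flow_measure /=.
  rewrite (_ : _ `&` _ = `]fpos p, fpos q]%classic); last first.
    apply/seteqP; split => x /=.
      by rewrite /ftime0 !in_itv/= => -[+ /RposE x0]; rewrite x0 ftime_leE// ftime_ltE.
    rewrite in_itv/= => /andP[px xq].
    have x0 : 0 < x by apply: lt_trans px; exact: fpos_gt0.
    by split; [rewrite /ftime0 x0 in_itv/= ftime_leE// ftime_ltE// px|exact/RposE].
  have [pq|qp] := ltP p q; last first.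
    rewrite !set_itv_ge ?bnd_simp -?leNgt//; last exact: fpos_le.
    by rewrite measure0 integral_set0.
  have Gpq := fpos_le (ltW pq).
  rewrite lebesgue_measure_itv/= lte_fin pq integral_itv_obnd_cbnd; last first.
    by apply/measurable_EFinP; apply: measurable_funTS; exact: measurable_rV0.
  rewrite -EFinB -{1}(fposK q) -{1}(fposK p) ftimeE ?fpos_gt0//; apply: eq_integral => x /set_mem xs.
  by rewrite /rV0 (iffLR (RposE x) (sub_itv_Rpos (fpos_gt0 p) xs)).
rewrite ge0_integral_pushforward//=; last 2 first.
- exact/measurable_EFinP.
- by move=> u _; rewrite lee_fin.
rewrite (@integral_density _ flow_measure Rpos rV0)//; last 4 first.
- exact: measurable_Rpos.
- by apply: measurable_funTS; exact: measurable_rV0.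
- by move=> x _; exact: rV0_ge0.
- exact: measurableT_comp mf measurable_ftime0.
by apply: eq_integral => x /set_mem /RposE x0; rewrite /ftime0 /rV0 x0.
Qed.

End flow.

(** * The transport semigroup in the time coordinate *)

(** Lets the filter lemmas apply to properties that hold almost everywhere for the
    Lebesgue measure of the line. *)
#[global] Instance lebesgue_ae_filter (R : realType) :
  Filter (nbhs (almost_everywhere (@lebesgue_measure R))).
Proof. exact: ae_filter_ringOfSetsType. Qed.

Section transport_resolvent.
Context {R : realType}.
Local Notation leb := (@lebesgue_measure R).
Variables (r a w : R -> R) (om : R) (mu : {measure set R -> \bar R}).
Hypotheses (r_cont : {within Rpos, continuous r}) (r_gt0 : forall x, 0 < x -> 0 < r x).
Hypothesis r_div0 : (\int[leb]_(tau in `]0%R, 1%R]) ((r tau)^-1)%:E = +oo)%E.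
Hypothesis r_divy : (\int[leb]_(tau in [set x : R | (1 <= x)%R]) ((r tau)^-1)%:E = +oo)%E.
Hypotheses (a_loc : locally_integrable Rpos a) (a_ge0 : forall x, 0 < x -> 0 <= a x).
Hypothesis a_thin : forall c : R, 0 < c ->
  (\int[leb]_(y in Rpos) (\1_[set z | (a z < c)%R] y * (r y)^-1)%:E < +oo)%E.
Hypotheses (mw : measurable_fun setT w) (w_ge0 : forall x, 0 <= w x).
Hypothesis w_gt0 : forall x, 0 < x -> 0 < w x.
Hypothesis muE : forall X, measurable X -> mu X = (\int[leb]_(x in X `&` Rpos) (w x)%:E)%E.
Local Notation H := (ftime r).
Local Notation G := (fpos r).
Hypothesis w_growth : forall x y, 0 < x -> x <= y -> w y <= expR (om * (H y - H x)) * w x.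

Let A u := a (G u).
Let W u := w (G u).
Let rG u := r (G u).

Let G0 u : 0 < G u. Proof. exact: (fpos_gt0 r_cont r_gt0 r_div0 r_divy). Qed.
Let HGu u : H (G u) = u. Proof. exact: (fposK r_cont r_gt0 r_div0 r_divy). Qed.
Let GHx x : 0 < x -> G (H x) = x. Proof. exact: (ftimeK r_cont r_gt0 r_div0 r_divy). Qed.
Let mG : measurable_fun setT G. Proof. exact: (measurable_fpos r_cont r_gt0 r_div0 r_divy). Qed.
Let Gle u v : u <= v -> G u <= G v. Proof. exact: (fpos_le r_cont r_gt0 r_div0 r_divy). Qed.

Lemma measurable_comp_G (f : R -> R) : measurable_fun Rpos f -> measurable_fun setT (f \o G).
Proof.
move=> mf; apply: (measurable_comp _ _ mf mG); first exact: measurable_Rpos.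
by move=> _ [u _ <-]; apply/RposE.
Qed.

Let measurable_a : measurable_fun Rpos a. Proof. by case: a_loc. Qed.

Let mA : measurable_fun setT A. Proof. exact: measurable_comp_G measurable_a. Qed.
Let A_ge0 u : 0 <= A u. Proof. exact: a_ge0. Qed.
Let mW : measurable_fun setT W. Proof. exact: measurableT_comp mw mG. Qed.
Let W_gt0 u : 0 < W u. Proof. exact: w_gt0. Qed.
Let mrG : measurable_fun setT rG. Proof. exact: measurable_comp_G (measurable_r r_cont). Qed.
Let rG_gt0 u : 0 < rG u. Proof. exact: r_gt0. Qed.

Lemma W_growth s u : s <= u -> W u <= expR (om * (u - s)) * W s.
Proof. by move=> su; have := w_growth (G0 s) (Gle su); rewrite !HGu. Qed.

Lemma integral_flow (f : R -> R) : measurable_fun setT f -> (forall u, 0 <= f u) ->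
  (\int[leb]_u (f u)%:E = \int[leb]_(x in Rpos) (f (H x) * (r x)^-1)%:E)%E.
Proof. exact: change_of_variables. Qed.

Lemma integral_A s u : s <= u ->
  (\int[leb]_(v in `[s, u]) (A v)%:E = \int[leb]_(x in `[G s, G u]) (a x / r x)%:E)%E.
Proof.
move=> su; rewrite integral_mkcond.
transitivity (\int[leb]_v (A v * \1_(`[s, u]%classic) v)%:E)%E.
  by apply: eq_integral => v _; rewrite patchE indicE; case: ifP => _; rewrite ?mulr1 ?mulr0.
rewrite integral_flow; last 2 first.
- by apply: measurable_funM; [exact: mA|exact: measurable_indic].
- by move=> v; rewrite mulr_ge0 ?A_ge0// indicE.
rewrite integral_mkcond [RHS]integral_mkcond; apply: eq_integral => x _.
rewrite !patchE !mem_setE !in_itv/= andbT.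
have [x0|x0] := ltP 0 x; last first.
  by rewrite (leNgt (G s)) (le_lt_trans x0 (G0 s)).
rewrite /A indicE mem_setE in_itv/= GHx//.
rewrite (fpos_leE r_cont r_gt0 r_div0 r_divy)// (ftime_leE r_cont r_gt0 r_div0 r_divy)//.
by case: (_ && _); rewrite ?mulr1 ?mulr0 ?mul0r.
Qed.

(** 1/r is bounded on the compact interval [G s, G u], where a is integrable. *)
Lemma A_integrable s u : leb.-integrable `[s, u] (EFin \o A).
Proof.
apply/integrableP; split.
  by apply/measurable_EFinP; apply: measurable_funTS; exact: mA.
have [su|us] := leP s u; last first.
  by rewrite set_itv_ge ?integral_set0// bnd_simp -ltNge.
under eq_integral do rewrite /= ger0_norm ?A_ge0//.
rewrite integral_A//.
have [c cs rc] := EVT_max (Gle su) (@rV_cont_itv _ _ r_cont r_gt0 (G s) (G u) (G0 s)).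
have sub := @sub_itv_Rpos _ (G s) (G u) (G0 s).
have mas : measurable_fun `[G s, G u] a.
  by apply: measurable_funS measurable_a => //; exact: measurable_Rpos.
have mrs : measurable_fun `[G s, G u] (fun x => (r x)^-1).
  by apply: measurable_funS (measurable_rV r_cont r_gt0) => //; exact: measurable_Rpos.
apply: (@le_lt_trans _ _ (\int[leb]_(x in `[G s, G u]) ((r c)^-1%:E * `|a x|%:E))%E).
  apply: ge0_le_integral => //.
  - by move=> x /sub /RposE x0; rewrite lee_fin mulr_ge0 ?a_ge0 ?invr_ge0 ?(ltW (r_gt0 x0)).
  - by apply/measurable_EFinP; apply: measurable_funM.
  - by apply: measurable_funeM; apply/measurable_EFinP; apply: measurableT_comp.
  - move=> x xs; have /RposE x0 := sub _ xs; rewrite -EFinM lee_fin mulrC.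
    by rewrite ger0_norm ?a_ge0// ler_wpM2r ?a_ge0//; exact: rc.
have rc0 : 0 <= (r c)^-1.
  by rewrite invr_ge0 ltW// r_gt0//; apply/RposE/sub.
rewrite ge0_integralZl//; last first.
  by apply/measurable_EFinP; apply: measurableT_comp.
apply: lte_mul_pinfty => //; case: a_loc => _ _; apply => //; exact: segment_compact.
Qed.

Lemma A_thin c : 0 < c -> (leb [set u | (A u < c)%R] < +oo)%E.
Proof.
move=> c0; have mS : measurable [set u | A u < c].
  have -> : [set u | A u < c] = A @^-1` `]-oo, c[%classic.
    by apply/seteqP; split => u; rewrite /= in_itv.
  by rewrite -[X in measurable X]setTI; exact: mA.
apply: le_lt_trans (a_thin c0).
have -> : leb [set u | (A u < c)%R] = (\int[leb]_u (\1_[set u | (A u < c)%R] u)%:E)%E.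
  by rewrite integral_indic// setIT.
rewrite integral_flow; last 2 first.
- exact: measurable_indic.
- by move=> u; rewrite indicE.
rewrite le_eqVlt; apply/orP; left; apply/eqP; apply: eq_integral => x /set_mem /RposE x0.
by rewrite !indicE; congr ((_ %:R * _)%:E); congr (nat_of_bool _);
  apply/idP/idP; rewrite !inE /= /A GHx.
Qed.

(** The two densities of the change of variables: dx = r(G u) du and w(x) = W u. *)
Lemma integral_mu (f : R -> R) : measurable_fun setT f -> (forall x, 0 <= f x) ->
  (\int[mu]_x (f x)%:E = \int[leb]_u (f (G u) * rG u * W u)%:E)%E.
Proof.
move=> mf f0.
rewrite (@integral_density _ mu Rpos w)//; last 2 first.
- exact: measurable_Rpos.
- exact: measurable_funTS.
rewrite integral_flow; last 2 first.
- apply: measurable_funM; last exact: mW.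
  by apply: measurable_funM; [exact: measurableT_comp mf mG|exact: mrG].
- by move=> u; rewrite !mulr_ge0// ?ltW// ?rG_gt0 ?W_gt0.
apply: eq_integral => x /set_mem /RposE x0; rewrite /rG /W GHx//; congr EFin.
by field; rewrite gt_eqF// r_gt0.
Qed.

(** The density r(G u) W u is positive, so G^{-1} maps mu-null sets to
    Lebesgue-null sets. *)
Lemma ae_G (Pr : R -> Prop) : (\forall y \ae mu, 0 < y -> Pr y) ->
  \forall u \ae leb, Pr (G u).
Proof.
move=> [N [mN N0 sub]].
have mI : measurable_fun setT (\1_N : R -> R) by exact: measurable_indic.
have I0 := @integral_mu \1_N mI (fun x => ler0n _ _).
rewrite integral_indic// setIT N0 in I0.
have mF : measurable_fun setT (fun u => \1_N (G u) * rG u * W u).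
  apply: measurable_funM; last exact: mW.
  by apply: measurable_funM; [exact: measurableT_comp mI mG|exact: mrG].
have I1 : (\int[leb]_u `|(\1_N (G u) * rG u * W u)%:E| = 0)%E.
  rewrite [RHS]I0; apply: eq_integral => u _; rewrite gee0_abs// lee_fin.
  by rewrite !mulr_ge0 ?(ltW (rG_gt0 _)) ?(ltW (W_gt0 _))// indicE.
have mFe : measurable_fun setT (fun u => (\1_N (G u) * rG u * W u)%:E).
  exact/measurable_EFinP.
have := iffLR (ae_eq_integral_abs leb measurableT mFe) I1.
apply: filterS => u /(_ I) /= [Fu0].
apply: contrapT => nP; have NGu : N (G u).
  by apply: sub => /= h; apply: nP; apply: h; exact: G0.
move: Fu0; rewrite indicE mem_set//= mul1r => /eqP.
by rewrite mulf_eq0 !gt_eqF ?rG_gt0 ?W_gt0.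
Qed.

Local Notation X := (LspaceType1 mu).
Local Notation wnorm := (wnorm W).
Local Notation green_op := (green_op A om).
Local Notation damped_shift := (damped_shift A).

(** The density of f dx in the time coordinate. *)
Definition pull (f : R -> R) (u : R) : R := rG u * f (G u).

Lemma measurable_pull (f : R -> R) : measurable_fun setT f -> measurable_fun setT (pull f).
Proof.
by move=> mf; apply: measurable_funM; [exact: mrG|exact: measurableT_comp mf mG].
Qed.

Let mpull (x : X) : measurable_fun setT (pull x).
Proof. by apply: measurable_pull; exact: L1_repr_mfun. Qed.

Lemma norm_pull (x : X) : (`|x|%:E = wnorm (pull x))%E.
Proof.
rewrite L1_normE integral_mu//; last first.
  by apply: measurableT_comp => //; exact: L1_repr_mfun.
apply: eq_integral => u _; rewrite /pull normrM (gtr0_norm (rG_gt0 u)).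
by rewrite (mulrC (rG u)).
Qed.

Lemma pull_wnorm (x : X) : (wnorm (pull x) < +oo)%E.
Proof. by rewrite -norm_pull ltry. Qed.

Lemma wnorm_ae (F F' : R -> R) : measurable_fun setT F -> measurable_fun setT F' ->
  (\forall u \ae leb, F u = F' u) -> wnorm F = wnorm F'.
Proof.
move=> mF mF' FF'; apply: ge0_ae_eq_integral => //.
- apply/measurable_EFinP; apply: measurable_funM; [exact: measurableT_comp|exact: mW].
- apply/measurable_EFinP; apply: measurable_funM; [exact: measurableT_comp|exact: mW].
- by move=> u _; rewrite lee_fin mulr_ge0// ltW// W_gt0.
- by move=> u _; rewrite lee_fin mulr_ge0// ltW// W_gt0.
- by apply: filterS FF' => u -> _.
Qed.

Lemma pull_add (x y : X) : \forall u \ae leb, pull (x + y) u = pull x u + pull y u.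
Proof.
have := L1_addE x y => h.
have : \forall t \ae mu, 0 < t -> (x + y : X) t = x t + y t.
  by apply: filterS h => t /(_ I) e _; exact: e.
by move=> /ae_G; apply: filterS => u e; rewrite /pull e mulrDr.
Qed.

Lemma pull_opp (x : X) : \forall u \ae leb, pull (- x) u = - pull x u.
Proof.
have : \forall t \ae mu, 0 < t -> (- x : X) t = - x t.
  by apply: filterS (L1_oppE x) => t /(_ I) e _; exact: e.
by move=> /ae_G; apply: filterS => u e; rewrite /pull e mulrN.
Qed.

Lemma pull_scale (c : R) (x : X) : \forall u \ae leb, pull (c *: x) u = c * pull x u.
Proof.
have : \forall t \ae mu, 0 < t -> (c *: x : X) t = c * x t.
  by apply: filterS (L1_scaleE c x) => t /(_ I) e _; exact: e.
by move=> /ae_G; apply: filterS => u e; rewrite /pull e mulrCA.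
Qed.

Lemma pull_zero : \forall u \ae leb, pull (0 : X) u = 0.
Proof.
have : \forall t \ae mu, 0 < t -> (0 : X) t = 0.
  by apply: filterS (L1_zeroE mu) => t /(_ I) e _; exact: e.
by move=> /ae_G; apply: filterS => u e; rewrite /pull e mulr0.
Qed.

Lemma pull_sub (x y : X) : \forall u \ae leb, pull (x - y) u = pull x u - pull y u.
Proof.
have := pull_add x (- y); have := pull_opp y.
by apply: filterS2 => u e1 ->; rewrite e1.
Qed.

Lemma pull_sum n (c : 'I_n -> R) (x : 'I_n -> X) :
  \forall u \ae leb, pull (\sum_j c j *: x j) u = \sum_j c j * pull (x j) u.
Proof.
elim: n c x => [|n IH] c x.
  by rewrite big_ord0; apply: filterS pull_zero => u ->; rewrite big_ord0.
rewrite big_ord_recr /=.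
have := pull_add (\sum_(i < n) c (widen_ord (leqnSn n) i) *: x (widen_ord (leqnSn n) i))
  (c ord_max *: x ord_max).
have := pull_scale (c ord_max) (x ord_max).
have := IH (fun i => c (widen_ord (leqnSn n) i)) (fun i => x (widen_ord (leqnSn n) i)).
by apply: filterS3 => u e1 e2 ->; rewrite e1 e2 big_ord_recr.
Qed.

Lemma norm_ae (x : X) (F : R -> R) : measurable_fun setT F ->
  (\forall u \ae leb, pull x u = F u) -> (`|x|%:E = wnorm F)%E.
Proof. by move=> mF xF; rewrite norm_pull; apply: wnorm_ae => //; exact: mpull. Qed.

Lemma pull_inj (x y : X) : (\forall u \ae leb, pull x u = pull y u) -> x = y.
Proof.
move=> xy; apply/eqP; rewrite -subr_eq0 -normr_eq0 -eqe; apply/eqP.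
rewrite (@norm_ae _ (cst 0))//.
  by rewrite /wnorm; under eq_integral do rewrite normr0 mul0r; rewrite integral0.
by have := pull_sub x y; move: xy; apply: filterS2 => u -> ->; rewrite subrr.
Qed.

(** The inverse of pull is F |-> F (H y) / r y. *)
Lemma pull_surj (F : R -> R) : measurable_fun setT F -> (wnorm F < +oo)%E ->
  exists x : X, \forall u \ae leb, pull x u = F u.
Proof.
move=> mF FW.
pose S y := F (ftime0 r y) * rV0 r y.
have mS : measurable_fun setT S.
  apply: measurable_funM; last exact: (measurable_rV0 r_cont r_gt0).
  exact: measurableT_comp mF (measurable_ftime0 r_cont r_gt0).
have SE u : pull S u = F u.
  rewrite /pull /S /ftime0 /rV0 G0 HGu /rG; field.
  by rewrite gt_eqF// r_gt0.
have [|x xS] := @L1_exists _ _ _ mu S mS.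
  rewrite integral_mu//; last exact: measurableT_comp.
  apply: le_lt_trans FW; rewrite le_eqVlt; apply/orP; left; apply/eqP.
  apply: eq_integral => u _; have -> : F u = rG u * S (G u) by rewrite -SE.
  by rewrite (normrM (rG u)) (gtr0_norm (rG_gt0 u)) (mulrC (rG u)).
exists x.
have : \forall t \ae mu, 0 < t -> (x : X) t = S t.
  by apply: filterS xS => t /(_ I) e _; exact: e.
by move=> /ae_G; apply: filterS => u e; rewrite -SE /pull e.
Qed.

Let Aint := A_integrable.

Lemma green_op_ae (F F' : R -> R) u : measurable_fun setT F -> measurable_fun setT F' ->
  (\forall v \ae leb, F v = F' v) -> green_op F u = green_op F' u.
Proof.
move=> mF mF' FF'; rewrite /green_op /Rintegral; congr fine.
have mK : measurable_fun setT (green A om ^~ u) by exact: measurable_green1 Aint u.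
apply: ae_eq_integral => //.
- by apply/measurable_EFinP; exact: measurable_funM.
- by apply/measurable_EFinP; exact: measurable_funM.
- by apply: filterS FF' => v -> _.
Qed.

Lemma green_op_linear (c : R) (F F' : R -> R) u :
  measurable_fun setT F -> measurable_fun setT F' -> (wnorm F < +oo)%E -> (wnorm F' < +oo)%E ->
  green_op (fun v => c * F v + F' v) u = c * green_op F u + green_op F' u.
Proof.
move=> mF mF' FW FW'.
have i1 := green_integrable A_ge0 Aint mW W_gt0 W_growth mF FW u.
have i2 := green_integrable A_ge0 Aint mW W_gt0 W_growth mF' FW' u.
rewrite /green_op -RintegralZl// -RintegralD//; last exact: leb_integrableZl i1.
by apply: eq_Rintegral => s _; rewrite mulrDr mulrCA.
Qed.

Lemma ae_translate (Pr : R -> Prop) t : (\forall u \ae leb, Pr u) ->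
  \forall u \ae leb, Pr (u - t).
Proof.
move=> [N [mN N0 sub]].
have mt : measurable_fun setT (fun u : R => u - t) by exact: measurable_funB.
exists ((fun u => u - t) @^-1` N); split.
- by rewrite -[X in measurable X]setTI; exact: mt.
- have mI : measurable_fun setT (\1_N : R -> R) by exact: measurable_indic.
  have mI' : measurable_fun setT (EFin \o (\1_N : R -> R)) by exact/measurable_EFinP.
  have I0 x : (0 <= (EFin \o (\1_N : R -> R)) x)%E by rewrite /= lee_fin indicE.
  have mP : measurable ((fun u => u - t) @^-1` N).
    by rewrite -[X in measurable X]setTI; exact: mt.
  have iN : (\int[leb]_u (EFin \o (\1_N : R -> R)) u = 0)%E.
    by rewrite -N0 -[in RHS](setIT N) -integral_indic.
  rewrite -(setIT (_ @^-1` N)) -integral_indic//.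
  by rewrite -[RHS]iN -(integral_translate (- t) mI' I0); apply: eq_integral => u _.
- by move=> u nP; exact: (sub (u - t) nP).
Qed.

Lemma damped_shift_ae (F F' : R -> R) t : (\forall v \ae leb, F v = F' v) ->
  \forall v \ae leb, damped_shift t F v = damped_shift t F' v.
Proof. by move=> /(ae_translate t); apply: filterS => u e; rewrite /damped_shift e. Qed.

(** X(G u, t) lies t units of time before G u; it is unique because H is
    injective. *)
Lemma backward_flowE u t : 0 <= t -> backward_flow r (G u) t = G (u - t).
Proof.
move=> t0; rewrite /backward_flow.
have ut : G (u - t) <= G u by apply: Gle; rewrite gerBl.
case: xgetP => [x _ [/andP[x0 xu] /esym e]|/(_ (G (u - t))) []].
  rewrite -(ftimeE r_cont r_gt0)// HGu in e.
  by rewrite -(GHx x0); congr (G _); case: e => ->; rewrite subKr.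
split; first by rewrite G0 ut.
by rewrite -(ftimeE r_cont r_gt0)// !HGu subKr.
Qed.

(** The factor r(X) / r(y) of the transport formula is the one that pull removes,
    and the integral of a / r is that of A in the time coordinate. *)
Lemma transport_pull t f u : 0 <= t ->
  rG u * transport_formula r a t f (G u) = damped_shift t (pull f) u.
Proof.
move=> t0; rewrite /transport_formula backward_flowE//.
have ut : u - t <= u by rewrite gerBl.
have -> : \int[leb]_(p in `[G (u - t), G u]) (a p / r p) =
    damping A u - damping A (u - t).
  apply: EFin_inj; rewrite (dampingE Aint)// integral_A// /Rintegral fineK//.
  by rewrite -integral_A//; apply: integrable_fin_num => //; exact: Aint.
rewrite /damped_shift /pull mulrCA; congr (_ * _); rewrite /rG; field.
by rewrite gt_eqF// r_gt0.
Qed.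

Variable U : R -> X -> X.
Hypotheses (UC : C0_semigroup U) (UT : given_by_transport r a U).
Local Notation lam := (om + 1).

Lemma pull_U t (f : X) : 0 <= t -> \forall u \ae leb, pull (U t f) u = damped_shift t (pull f) u.
Proof.
move=> t0; have := ae_G (UT f t0); apply: filterS => u e.
by rewrite /pull e -transport_pull.
Qed.

Let measurable_green_op' F mF := @measurable_green_op R A om Aint F mF.
Let kb F mF FW := @green_op_contraction R A W om mA A_ge0 Aint mW W_gt0 W_growth F mF FW.

(** green_op acts on functions up to null sets and preserves L^1(W du), so it
    transports to an operator of X, here through a choice of preimages. *)
Lemma resolvent_exists : exists K : {linear X -> X},
  forall f, \forall u \ae leb, pull (K f) u = green_op (pull f) u.
Proof.
have /choice [K0 K0E] : forall f : X, exists x : X, \forall u \ae leb, pull x u = green_op (pull f) u.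
  move=> f; apply: pull_surj; first by apply: measurable_green_op'; exact: mpull.
  by apply: le_lt_trans (kb (mpull f) (pull_wnorm f)) _; exact: pull_wnorm.
have lin : linear K0.
  move=> c x y; apply: pull_inj.
  have := pull_add (c *: K0 x) (K0 y); have := pull_scale c (K0 x).
  have kE u : green_op (pull (c *: x + y)) u = c * green_op (pull x) u + green_op (pull y) u.
    rewrite -green_op_linear; [|exact: mpull|exact: mpull|exact: pull_wnorm|exact: pull_wnorm].
    apply: green_op_ae; first exact: mpull.
      by apply: measurable_funD; [apply: measurable_funM => //|]; exact: mpull.
    have := pull_add (c *: x) y; have := pull_scale c x.
    by apply: filterS2 => v e1 ->; rewrite e1.
  move=> e1 e2; have e3 : \forall u \ae leb,
      pull (c *: K0 x + K0 y) u = c * pull (K0 x) u + pull (K0 y) u.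
    by move: e1 e2; apply: filterS2 => u h1 ->; rewrite h1.
  have e4 : \forall u \ae leb, pull (c *: K0 x + K0 y) u = green_op (pull (c *: x + y)) u.
    by move: (K0E x) (K0E y) e3; apply: filterS3 => u h1 h2 ->; rewrite h1 h2 kE.
  by move: (K0E (c *: x + y)) e4; apply: filterS2 => u -> ->.
pose K1 : {linear X -> X} := HB.pack K0 (GRing.isLinear.Build R X X _ K0 lin).
by exists K1; exact: K0E.
Qed.

Section K.
Variable K : {linear X -> X}.
Hypothesis KE : forall f, \forall u \ae leb, pull (K f) u = green_op (pull f) u.

Lemma K_norm f : `|K f| <= `|f|.
Proof.
rewrite -lee_fin (norm_ae (measurable_green_op' (mpull f)) (KE f)) norm_pull.
exact: kb (mpull f) (pull_wnorm f).
Qed.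

Lemma K_continuous : continuous K.
Proof.
apply: bounded_linear_continuous; apply/linear_boundedP.
exists 1; split; first exact: num_real.
by move=> M /ltW M1 x; apply: le_trans (K_norm x) _; rewrite ler_peMl.
Qed.

Lemma K_U t f : 0 <= t -> K (U t f) = U t (K f).
Proof.
move=> t0; apply: pull_inj.
have := KE (U t f); have := pull_U (K f) t0; have := damped_shift_ae t (KE f).
apply: filterS3 => u e1 e2 e3; rewrite e3 e2 e1.
rewrite -(green_op_shift A_ge0 Aint mW W_gt0 W_growth (mpull f) (pull_wnorm f)).
apply: green_op_ae; [exact: mpull|exact: (measurable_damped_shift Aint (mpull f))|exact: pull_U].
Qed.

(** K g - e^{- lam t} U(t) K g is the integral of e^{- lam tau} U(tau) g over [0, t],
    hence is t g up to t times the oscillation d of the integrand. *)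
Lemma resolvent_increment t (d : R) g : 0 <= t -> 0 <= d ->
  (forall tau, 0 <= tau -> tau <= t -> `|expR (- (lam * tau)) *: U tau g - g| <= d) ->
  `|(K g - expR (- (lam * t)) *: U t (K g)) - t *: g| <= t * d.
Proof.
move=> t0 d0 Ud.
pose F := pull g.
have mF : measurable_fun setT F by exact: mpull.
have mV' tau : measurable_fun setT (fun u => expR (- (lam * tau)) * damped_shift tau F u - F u).
  by apply: measurable_funB => //; apply: measurable_funM => //; exact: (measurable_damped_shift Aint mF).
pose D u := (green_op F u - expR (- (lam * t)) * damped_shift t (green_op F) u) - t * F u.
have mD : measurable_fun setT D.
  apply: measurable_funB; last exact: measurable_funM.
  apply: measurable_funB; first exact: measurable_green_op'.
  by apply: measurable_funM => //; apply: (measurable_damped_shift Aint); exact: measurable_green_op'.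
rewrite -lee_fin (@norm_ae _ D)//; last first.
  have e1 := pull_sub (K g - expR (- (lam * t)) *: U t (K g)) (t *: g).
  have e2 := pull_sub (K g) (expR (- (lam * t)) *: U t (K g)).
  have e3 := pull_scale t g.
  have e4 := pull_scale (expR (- (lam * t))) (U t (K g)).
  have e5 := pull_U (K g) t0.
  have e6 := damped_shift_ae t (KE g).
  have e7 : \forall u \ae leb, pull (K g - expR (- (lam * t)) *: U t (K g)) u =
      green_op F u - expR (- (lam * t)) * pull (U t (K g)) u.
    by move: e2 e4 (KE g); apply: filterS3 => u h1 h2 h3; rewrite h1 h2 h3.
  have e8 : \forall u \ae leb, pull (U t (K g)) u = damped_shift t (green_op F) u.
    by move: e5 e6; apply: filterS2 => u h1 h2; rewrite h1 h2.
  have e9 : \forall u \ae leb,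
      pull ((K g - expR (- (lam * t)) *: U t (K g)) - t *: g) u =
      (green_op F u - expR (- (lam * t)) * pull (U t (K g)) u) - t * F u.
    by move: e1 e3 e7; apply: filterS3 => u h1 h2 h3; rewrite h1 h2 h3.
  by move: e8 e9; apply: filterS2 => u h1 h2; rewrite h2 h1.
rewrite /wnorm /D.
under eq_integral do rewrite (green_op_increment A_ge0 Aint mW W_gt0 W_growth mF (pull_wnorm g) _ t0).
apply: (green_op_increment_approx A_ge0 Aint mW W_gt0 W_growth mF (pull_wnorm g) t0 d0) => tau tau0 taut.
have := Ud tau tau0 taut; rewrite -lee_fin => h; apply: le_trans h.
rewrite (@norm_ae _ _ (mV' tau))//.
have e1 := pull_sub (expR (- (lam * tau)) *: U tau g) g.
have e2 := pull_scale (expR (- (lam * tau))) (U tau g).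
have e3 := pull_U g tau0.
by move: e1 e2 e3; apply: filterS3 => u h1 h2 h3; rewrite h1 h2 h3.
Qed.

Lemma expR_slope_cvg : t^-1 * (expR (lam * t) - 1) @[t --> 0^'+] --> lam.
Proof.
have D : is_derive (0 : R) (1 : R) (fun t => expR (lam * t)) lam.
  apply: is_derive_eq; rewrite mulr0 expR0.
  by rewrite /GRing.scale /=; ring.
case: D => dv Dlam; rewrite -[X in _ --> X]Dlam; apply: cvg_dnbhs_at_right.
move: dv; rewrite /derivable /derive => dv.
apply: cvg_trans dv; apply: near_eq_cvg; near=> t => /=.
by rewrite mulr0 expR0 addr0 /GRing.scale /= [t * 1]mulr1.
Unshelve. all: end_near. Qed.

Lemma damped_orbit_cvg (g : X) : expR (- (lam * t)) *: U t g @[t --> 0^'+] --> g.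
Proof.
case: UC => _ _ _ U0; rewrite -[X in _ --> X]scale1r.
apply: cvgZ; last exact: U0.
rewrite -[X in _ --> X]expR0; apply: continuous_cvg; first exact: continuous_expR.
rewrite -[X in _ --> X]oppr0; apply: cvgN.
rewrite -[X in _ --> X](mulr0 lam); apply: cvgMl_tmp; exact: cvg_at_right_filter.
Qed.

Lemma damped_difference_cvg (g : X) :
  t^-1 *: (K g - expR (- (lam * t)) *: U t (K g)) @[t --> 0^'+] --> g.
Proof.
case: UC => _ U0 _ _.
apply/cvgrPdist_le => e e0.
have /cvgrPdist_le /(_ _ e0) := @damped_orbit_cvg g.
move=> /nbhs_ballP[d d0 dP].
near=> t.
have t0 : 0 < t by near: t; exact: nbhs_right_gt.
have td : t < d by near: t; exact: nbhs_right_lt.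
have h : `|(K g - expR (- (lam * t)) *: U t (K g)) - t *: g| <= t * e.
  apply: resolvent_increment; [exact: ltW|exact: ltW|] => tau tau0 taut.
  move: tau0; rewrite le_eqVlt => /orP[/eqP <-|tau0].
    by rewrite mulr0 oppr0 expR0 U0 scale1r subrr normr0 ltW.
  rewrite distrC; apply: dP => //.
  by rewrite /ball /= sub0r normrN gtr0_norm// (le_lt_trans taut).
rewrite distrC.
have -> : t^-1 *: (K g - expR (- (lam * t)) *: U t (K g)) - g =
  t^-1 *: ((K g - expR (- (lam * t)) *: U t (K g)) - t *: g).
  by rewrite [RHS]scalerBr scalerA mulVf ?gt_eqF// scale1r.
by rewrite normrZ (gtr0_norm (_ : 0 < t^-1)) ?invr_gt0// ler_pdivrMl.
Unshelve. all: end_near. Qed.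

(** From U(t) h - h = (e^{lam t} - 1) h - e^{lam t} (h - e^{- lam t} U(t) h) with
    h = K g, after division by t. *)
Lemma generator_K (g : X) : generator U (K g) (lam *: K g - g).
Proof.
rewrite /generator.
have e t : t^-1 *: (U t (K g) - K g) = (t^-1 * (expR (lam * t) - 1)) *: K g -
    expR (lam * t) *: (t^-1 *: (K g - expR (- (lam * t)) *: U t (K g))).
  rewrite [expR (lam * t) *: (_ *: _)]scalerA (mulrC (expR _)) -!scalerA -scalerBr.
  congr (_ *: _); rewrite scalerBl scalerBr scale1r scalerA -expRD subrr expR0 scale1r.
  by rewrite opprB [RHS]addrC subrKA.
under eq_fun do rewrite e.
apply: cvgB; first by apply: cvgZr_tmp; exact: expR_slope_cvg.
rewrite -[X in _ --> X]scale1r.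
apply: cvgZ; last exact: damped_difference_cvg.
rewrite -[X in _ --> X]expR0; apply: continuous_cvg; first exact: continuous_expR.
rewrite -[X in _ --> X](mulr0 lam); apply: cvgMl_tmp; exact: cvg_at_right_filter.
Qed.

(** K is continuous and commutes with U, so K f is in the domain and is mapped
    to K h; by generator_K it is also mapped to lam K f - f. *)
Lemma K_left_inverse (f h : X) : generator U f h -> K (lam *: f - h) = f.
Proof.
move=> fh.
have Kh : t^-1 *: (U t (K f) - K f) @[t --> 0^'+] --> K h.
  have : K (t^-1 *: (U t f - f)) @[t --> 0^'+] --> K h.
    by apply: continuous_cvg; [exact: K_continuous|exact: fh].
  apply: cvg_trans; apply: near_eq_cvg; near=> t.
  rewrite linearZ linearB /= K_U//.
have := cvg_unique (@norm_hausdorff _ X) Kh (@generator_K f) => e.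
by rewrite linearB linearZ /= e opprB addrC subrK.
Unshelve. all: end_near. Qed.

Lemma resolvent_K : is_resolvent (generator U) lam K.
Proof.
split; [exact: K_continuous| |exact: K_left_inverse].
move=> g; exists (lam *: K g - g); first exact: generator_K.
by rewrite opprB addrC subrK.
Qed.

(** Transport of green_op_finite_rank: the coefficients are the values of
    green_op at the left ends of the cells, bounded by green_op_pointwise. *)
Lemma compact_K : compact_operator K.
Proof.
move=> B /bounded_setP[M0 BM0].
pose M := Num.max M0 0.
have M_ge0 : 0 <= M by rewrite le_max lexx orbT.
have BM x : B x -> `|x| <= M by move=> /BM0 h; rewrite le_max h.
apply: precompact_finite_rank; first exact: L1_cauchy_cvg.
move=> e e0.
have [n [q [h [h0 approx]]]] :=
  green_op_finite_rank mA A_ge0 Aint mW W_gt0 W_growth A_thin M_ge0 e0.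
pose p (j : nat) : R := q + j%:R * h.
have mC j : measurable_fun setT (cell A om (p j) h) by exact: measurable_cell.
have /choice[phi phiE] : forall j : nat, exists x : X, \forall u \ae leb,
    pull x u = cell A om (p j) h u.
  by move=> j; apply: pull_surj => //; exact: (cell_wnorm A_ge0 Aint mW W_gt0 W_growth _ h0).
exists n, (fun (j : 'I_n) (f : X) => green_op (pull f) (p j)), (fun j : 'I_n => phi j),
  (\sum_(j < n) M / W (p j)).
split=> [j f Bf|f Bf].
  have : `|green_op (pull f) (p j)| <= M / W (p j).
    rewrite ler_pdivlMr ?W_gt0// -lee_fin.
    apply: le_trans (green_op_pointwise A_ge0 Aint mW W_gt0 W_growth (mpull f) (pull_wnorm f) _) _.
    by rewrite -norm_pull lee_fin BM.
  move=> /le_trans; apply; rewrite (bigD1 j)//= lerDl sumr_ge0// => i _.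
  by rewrite divr_ge0// ltW// W_gt0.
rewrite -lee_fin.
have fM : (wnorm (pull f) <= M%:E)%E by rewrite -norm_pull lee_fin BM.
apply: le_trans (approx _ (mpull f) fM).
rewrite le_eqVlt; apply/orP; left; apply/eqP; apply: norm_ae.
  apply: measurable_funB; first exact: measurable_green_op' (mpull f).
  by apply: measurable_sum => j; apply: measurable_funM => //; exact: (mC j).
have phis : \forall u \ae leb, forall j : 'I_n, pull (phi j) u = cell A om (p j) h u.
  apply: filter_forall => j; exact: phiE.
have e1 := pull_sub (K f) (\sum_(j < n) green_op (pull f) (p j) *: phi j).
have e2 := @pull_sum n (fun j => green_op (pull f) (p j)) (fun j => phi j).
have e3 : \forall u \ae leb, pull (\sum_(j < n) green_op (pull f) (p j) *: phi j) u =
    \sum_(j < n) green_op (pull f) (p j) * cell A om (p j) h u.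
  move: e2 phis; apply: filterS2 => u -> ph; apply: eq_bigr => j _.
  by rewrite ph.
by move: e1 e3 (KE f); apply: filterS3 => u -> -> ->.
Qed.

End K.

Lemma transport_resolvent_compact : resolvent_compact (generator U).
Proof.
have [K KE] := resolvent_exists.
exact: resolvent_compact_one (resolvent_K KE) (compact_K KE).
Qed.

End transport_resolvent.

(** The spaces X_alpha and X_{0, alpha} together: c = 0 and c = 1. *)
Lemma resolvent_compact_weight (R : realType) (alpha c : R) (r a : R -> R)
  (mu : {measure set R -> \bar R}) (U : R -> LspaceType1 mu -> LspaceType1 mu) :
  0 < alpha -> 0 <= c ->
  (forall X, measurable X ->
    mu X = (\int[lebesgue_measure]_(x in X `&` Rpos) ((c + x) `^ alpha)%:E)%E) ->
  {within Rpos, continuous r} -> (forall x, 0 < x -> 0 < r x) ->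
  (\int[lebesgue_measure]_(tau in `]0%R, 1%R]) ((r tau)^-1)%:E = +oo)%E ->
  (\int[lebesgue_measure]_(tau in [set x : R | (1 <= x)%R]) ((r tau)^-1)%:E = +oo)%E ->
  locally_integrable Rpos a -> (forall x, 0 < x -> 0 <= a x) ->
  (forall c : R, 0 < c ->
    (\int[lebesgue_measure]_(y in Rpos)
       (\1_[set z | (a z < c)%R] y * (r y)^-1)%:E < +oo)%E) ->
  (ereal_sup [set (r z / (c + z))%:E | z in Rpos] < +oo)%E ->
  C0_semigroup U -> given_by_transport r a U -> resolvent_compact (generator U).
Proof.
move=> alpha0 c0 muE r_cont r_gt0 r_div0 r_divy a_loc a_ge0 a_thin r_sub UC UT.
have cx_gt0 x : 0 < x -> 0 < c + x by move=> x0; rewrite ltr_wpDl.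
have [C C0 rC] : exists2 C : R, 0 < C & forall z, 0 < z -> r z <= C * (c + z).
  have r1 : ((r 1 / (c + 1))%:E <= ereal_sup [set (r z / (c + z))%:E | z in Rpos])%E.
    by apply: ereal_sup_ubound; exists 1 => //; apply/RposE.
  have supE : ereal_sup [set (r z / (c + z))%:E | z in Rpos] =
      (fine (ereal_sup [set (r z / (c + z))%:E | z in Rpos]))%:E.
    by rewrite fineK// fin_real// (lt_le_trans _ r1) ?ltNyr.
  exists (fine (ereal_sup [set (r z / (c + z))%:E | z in Rpos])).
    by rewrite -lte_fin -supE (lt_le_trans _ r1)// lte_fin divr_gt0 ?r_gt0 ?cx_gt0.
  move=> z z0; rewrite -ler_pdivrMr ?cx_gt0// -lee_fin -supE.
  by apply: ereal_sup_ubound; exists z => //; apply/RposE.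
have mw : measurable_fun setT (fun x : R => (c + x) `^ alpha).
  by apply: (measurableT_comp (measurable_powR alpha)); exact: measurable_funD.
have w_growth x y : 0 < x -> x <= y ->
    (c + y) `^ alpha <= expR (alpha * C * (ftime r y - ftime r x)) * (c + x) `^ alpha.
  move=> x0 xy; apply: (weight_growth alpha0 c0 C0 x0 xy (measurable_r r_cont) r_gt0 rC).
  by rewrite -(ftimeE r_cont r_gt0).
apply: (transport_resolvent_compact r_cont r_gt0 r_div0 r_divy a_loc a_ge0 a_thin mw _ _
  muE w_growth UC UT).
- by move=> x; exact: powR_ge0.
- by move=> x x0; rewrite powR_gt0// cx_gt0.
Qed.

Theorem theorem4p7 (R : realType) (alpha : R) (r a : R -> R)
  (alpha_gt0 : 0 < alpha)
  (r_cont : {within Rpos, continuous r})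
  (r_gt0 : forall x, 0 < x -> 0 < r x)
  (r_div0 : (\int[lebesgue_measure]_(tau in `]0%R, 1%R]) ((r tau)^-1)%:E = +oo)%E)
  (r_divy : (\int[lebesgue_measure]_(tau in [set x : R | (1 <= x)%R]) ((r tau)^-1)%:E = +oo)%E)
  (a_loc : locally_integrable Rpos a)
  (a_ge0 : forall x, 0 < x -> 0 <= a x)
  (a_thin : forall c : R, 0 < c ->
    (\int[lebesgue_measure]_(y in Rpos)
       (\1_[set z | (a z < c)%R] y * (r y)^-1)%:E < +oo)%E) :
  ((ereal_sup [set (r z / z)%:E | z in Rpos] < +oo)%E ->
    forall U : R -> X_space alpha -> X_space alpha,
      C0_semigroup U -> given_by_transport r a U ->
      resolvent_compact (generator U)) /\
  ((ereal_sup [set (r z / (1 + z))%:E | z in Rpos] < +oo)%E ->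
    forall U : R -> X0_space alpha -> X0_space alpha,
      C0_semigroup U -> given_by_transport r a U ->
      resolvent_compact (generator U)).

Proof.
split=> r_sub U UC UT.
- apply: (resolvent_compact_weight alpha_gt0 (lexx 0) _ r_cont r_gt0 r_div0 r_divy
    a_loc a_ge0 a_thin _ UC UT).
    by move=> X _; under eq_integral do rewrite add0r.
  by under eq_fun do rewrite add0r.
- exact: (resolvent_compact_weight alpha_gt0 ler01 _ r_cont r_gt0 r_div0 r_divy
    a_loc a_ge0 a_thin r_sub UC UT).
Qed.
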